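(* Let $N\ge 2$, let $\mu_1<\mu_2<\cdots<\mu_N<0$, and let $a=(a_1,\dots,a_N)\in(\mathbb{R}\setminus\{0\})^N$. Let $U^a=(U^a_1,\dots,U^a_N)$ be the determinant solution and $\mathcal{L}_{U^a}$ the linearized operator defined in the context. Then $\dim\ker_{H^1(\mathbb{R})^N}\mathcal{L}_{U^a}=N$ and $$\ker_{H^1(\mathbb{R})^N}\mathcal{L}_{U^a}=\operatorname{span}\{\partial_{a_1}U^a,\dots,\partial_{a_N}U^a\}.$$
   Context: All functions are real-valued. Put $\eta_i=\sqrt{-\mu_i}>0$. For $a\in(\mathbb{R}\setminus\{0\})^N$ define $$U_i^a(x)=\frac{a_i e^{\eta_i x}\det(I+B^{(i)}M(x))}{\det(I+M(x))},\qquad i=1,\dots,N,$$ where $I$ is the $N\times N$ identity matrix, $M(x)=(m_{jk}(x))_{1\le j,k\le N}$ with $m_{jk}(x)=\frac{a_ja_k}{2\sqrt{\eta_j\eta_k}(\eta_j+\eta_k)}e^{(\eta_j+\eta_k)x}$, and $B^{(i)}=\operatorname{diag}\big(\frac{\eta_i-\eta_1}{\eta_i+\eta_1},\dots,\frac{\eta_i-\eta_N}{\eta_i+\eta_N}\big)$. The function $U^a$ solves $-u_i''-2(\sum_{j=1}^N u_j^2)u_i=\mu_iu_i$ in $\mathbb{R}$, $i=1,\dots,N$. Here $\partial_{a_k}U^a$ denotes the derivative of the family $a\mapsto U^a$ with respect to the parameter $a_k$. The linearized operator at $U^a$ is $$(\mathcal{L}_{U^a}\phi)_i:=-\phi_i''-\mu_i\phi_i-2\Big(\sum_{j=1}^N(U^a_j)^2\Big)\phi_i-4U_i^a\sum_{j=1}^NU_j^a\phi_j,\qquad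 i=1,\dots,N,$$ and $\ker_{H^1(\mathbb{R})^N}\mathcal{L}_{U^a}$ is the real vector space of all $\phi=(\phi_1,\dots,\phi_N)\in H^1(\mathbb{R})^N$ with $\mathcal{L}_{U^a}\phi=0$ on $\mathbb{R}$ (in the distributional sense). *)

(* Defs.v *)
From HB Require Import structures.
From mathcomp Require Import all_boot all_order all_algebra.
From mathcomp Require Import generic_quotient ring_quotient.
From mathcomp Require Import all_classical all_reals all_analysis.

Set Implicit Arguments.
Unset Strict Implicit.
Unset Printing Implicit Defensive.
Import Order.TTheory GRing.Theory Num.Theory.
Import numFieldNormedType.Exports.
Local Open Scope classical_set_scope.
Local Open Scope ring_scope.

Section LinearAlgebra.
Context {K : fieldType} {V : lmodType K}.

Definition lin_span (n : nat) (v : 'I_n -> V) : set V :=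
  [set u | exists c : 'I_n -> K, u = \sum_k c k *: v k].

Definition lin_indep (n : nat) (v : 'I_n -> V) : Prop :=
  forall c : 'I_n -> K, \sum_k c k *: v k = 0 -> forall k, c k = 0.

Definition has_dim (W : set V) (n : nat) : Prop :=
  exists2 b : 'I_n -> V, lin_indep b & W = lin_span b.

End LinearAlgebra.

Section AlmostEverywhereClasses.
Context (R : realType).
Local Notation mu := (@lebesgue_measure R).

Definition ae_zero : {pred R -> R} :=
  [pred f : R -> R | `[< {ae mu, forall x : measurableTypeR R, f x = 0} >]].

Lemma ae_zero_submod_closed : submod_closed ae_zero.
Proof.
split=> [|c f g /asboolP f0 /asboolP g0]; apply/asboolP; first exact: aeW.
apply: filterS2 f0 g0 => x fx gx.
by rewrite -[LHS]/(c *: f x + g x) fx gx scaler0 addr0.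
Qed.

HB.instance Definition _ :=
  GRing.isSubmodClosed.Build R (R -> R) ae_zero ae_zero_submod_closed.

(* Functions modulo equality almost everywhere. No measurability is built in:
   it is part of membership in H^1 below. *)
Definition aeclass : Type := Quotient.quot ae_zero.
HB.instance Definition _ := EqQuotient.on aeclass.
HB.instance Definition _ := Choice.on aeclass.
HB.instance Definition _ := GRing.Zmodule.on aeclass.

Definition aeclass_of (f : R -> R) : aeclass := \pi_(aeclass)%qT f.

Lemma aeclass_eqP (f g : R -> R) :
  aeclass_of f = aeclass_of g <->
  {ae mu, forall x : measurableTypeR R, f x = g x}.
Proof.
split=> [/eqmodP|fg].
  rewrite /= /Quotient.equiv => /asboolP; apply: filterS => x.
  by rewrite -[X in X = _]/(f x - g x) => /eqP; rewrite subr_eq0 => /eqP.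
apply/eqmodP/asboolP; move: fg; apply: filterS => x fg.
by rewrite -[LHS]/(f x - g x) fg subrr.
Qed.

Definition aeclass_scale (c : R) (u : aeclass) : aeclass :=
  aeclass_of (c *: (repr u : R -> R)).

Lemma aeclass_ofZ (c : R) (f : R -> R) :
  aeclass_scale c (aeclass_of f) = aeclass_of (c *: f).
Proof.
apply/aeclass_eqP; have /aeclass_eqP := reprK (aeclass_of f).
by apply: filterS => x fx; rewrite -[LHS]/(c *: _) fx.
Qed.

Lemma aeclass_ofD (f g : R -> R) :
  aeclass_of (f + g) = aeclass_of f + aeclass_of g.
Proof. by rewrite /aeclass_of !piE. Qed.

Lemma aeclass_surj (u : aeclass) : exists f, u = aeclass_of f.
Proof. by exists (repr u); rewrite /aeclass_of reprK. Qed.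

Lemma aeclass_scaleA (b c : R) (u : aeclass) :
  aeclass_scale b (aeclass_scale c u) = aeclass_scale (b * c) u.
Proof. by have [f ->] := aeclass_surj u; rewrite !aeclass_ofZ scalerA. Qed.

Lemma aeclass_scale1 : left_id 1 aeclass_scale.
Proof. by move=> u; have [f ->] := aeclass_surj u; rewrite aeclass_ofZ scale1r. Qed.

Lemma aeclass_scaleDr : right_distributive aeclass_scale +%R.
Proof.
move=> c u v; have [f ->] := aeclass_surj u; have [g ->] := aeclass_surj v.
by rewrite -aeclass_ofD !aeclass_ofZ scalerDr aeclass_ofD.
Qed.

Lemma aeclass_scaleDl (u : aeclass) : {morph aeclass_scale^~ u : b c / b + c}.
Proof.
by move=> b c; have [f ->] := aeclass_surj u; rewrite !aeclass_ofZ scalerDl aeclass_ofD.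
Qed.

HB.instance Definition _ := GRing.Zmodule_isLmodule.Build R aeclass
  aeclass_scaleA aeclass_scale1 aeclass_scaleDr aeclass_scaleDl.

End AlmostEverywhereClasses.

Section Distributions.
Context (R : realType).
Local Notation mu := (@lebesgue_measure R).

Definition test_function (psi : R -> R) : Prop :=
  (forall (n : nat) (x : R), derivable (derive1n n psi) x 1) /\
  compact (closure [set x | psi x != 0]).

(* Distributions are modelled by their action on functions; only the values at
   test functions are meaningful. *)
Definition distr : Type := (R -> R) -> R.

Definition distr_of (f : R -> R) : distr := fun psi => \int[mu]_x (f x * psi x).

Definition distr_deriv (T : distr) : distr := fun psi => - T (derive1 psi).

Definition eq_distr (S T : distr) : Prop :=
  forall psi, test_function psi -> S psi = T psi.

(* Representatives of elements of H^1: square integrable functions whose weak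
   derivative is square integrable. *)
Definition H1fun (f : R -> R) : Prop :=
  f \in Lfun mu 2%:E /\
  exists2 g : R -> R, g \in Lfun mu 2%:E &
    eq_distr (distr_deriv (distr_of f)) (distr_of g).

End Distributions.

Section Soliton.
Context {R : realType} {N : nat}.
Implicit Types (mu : 'I_N -> R) (a : 'rV[R]_N).

Definition eta mu (i : 'I_N) : R := Num.sqrt (- mu i).

Definition Mmat mu a (x : R) : 'M[R]_N :=
  \matrix_(j, k) (a 0 j * a 0 k /
      (2 * Num.sqrt (eta mu j * eta mu k) * (eta mu j + eta mu k))
    * expR ((eta mu j + eta mu k) * x)).

Definition Bmat mu (i : 'I_N) : 'M[R]_N :=
  diag_mx (\row_j ((eta mu i - eta mu j) / (eta mu i + eta mu j))).

Definition Usol mu a (i : 'I_N) (x : R) : R :=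
  a 0 i * expR (eta mu i * x) * \det (1%:M + Bmat mu i *m Mmat mu a x)
  / \det (1%:M + Mmat mu a x).

Definition dUsol mu a (k i : 'I_N) (x : R) : R :=
  'D_(delta_mx 0 k) (fun b : 'rV[R]_N => Usol mu b i x) a.

Definition linearized mu (U phi : 'I_N -> R -> R) (i : 'I_N) : distr R :=
  - distr_deriv (distr_deriv (distr_of (phi i)))
  - mu i *: distr_of (phi i)
  - 2 *: distr_of (fun x => (\sum_j U j x ^+ 2) * phi i x)
  - 4 *: distr_of (fun x => U i x * \sum_j U j x * phi j x).

Definition vclass (phi : 'I_N -> R -> R) : 'I_N -> aeclass R :=
  fun i => aeclass_of (phi i).

Definition kerH1 mu (U : 'I_N -> R -> R) : set ('I_N -> aeclass R) :=
  vclass @` [set phi | (forall i, H1fun (phi i)) /\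
                       (forall i, eq_distr (linearized mu U phi i) 0)].

End Soliton.

(* Main.v *)
Require Import Defs.
From mathcomp Require Import all_boot all_order all_algebra.
From mathcomp Require Import all_classical all_reals all_analysis.
From mathcomp Require Import measurable_realfun ring lra.
Import Order.TTheory GRing.Theory Num.Theory.
Import numFieldNormedType.Exports.
Local Open Scope classical_set_scope.
Local Open Scope ring_scope.

(* Write the linearized equation as phi'' = P(x) phi with P symmetric, so that the
   Wronskian of two solutions is constant. If both solutions and their derivatives
   are square integrable, it is integrable, hence zero: the initial data of the
   H^1 solutions form an isotropic subspace of R^N x R^N, of dimension at most N.
   It remains to see that the d_{a_k} U^a are N independent elements of it.

   For this, put z_j = a_j exp(eta_j x), L = diag(eta) and
   K = (z_j z_k / (eta_j + eta_k)). The matrix determinant lemma gives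
   U = 2 L y, where (2 L + K) y = z; the identity L K + K L = z z^T makes both the
   linearized equation and the derivatives in a explicit, and the Cauchy matrix
   (1 / (eta_j + eta_k)) is positive definite, which bounds the inverse of
   2 L + K and gives exponential decay at both ends.

   A distributional H^1 solution is a classical one: at Lebesgue points a < b of f,
   testing f' = g against smooth plateaus converging to the indicator of [a, b]
   yields f b - f a = \int_a^b g. *)

Set Implicit Arguments.
Unset Strict Implicit.
Unset Printing Implicit Defensive.

(** A variation [c] of the parameter enters through [b = c / a]: it moves z by diag(b) z, where a
    shift of x moves z by diag(eta) z. One differentiation rule therefore serves both x and the
    parameters, and y' is the derivative of y in the direction b = eta. Since A = 2 L + K has
    x-derivative z z^T, the inverse satisfies (A^-1)' = - y y^T, which keeps all derivatives
    explicit. Each second-order equation is then proved by applying A to both sides and commuting L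
    past A; no inverse remains, and the claim becomes a polynomial identity in coordinates.
    Independence is decided at -oo: if the derivative along b vanishes, then b_j = \sum_k (b_j +
    b_k) / (e_j + e_k) z_k y_k, whose right side tends to 0. The strict ordering of the mu_i enters
    as the nonsingularity of the Cauchy matrix, which controls y at +oo, where z blows up. Kernel
    elements are classes modulo equality almost everywhere, whereas the comparison of initial data
    at 0 needs continuous representatives of a solution and of its derivative; this is what the
    regularity argument supplies. *)

(** * Positive definiteness of the Cauchy matrix *)

Section CauchyForm.
Context {R : realFieldType}.

Definition cauchy_form n (e v : 'I_n -> R) : R :=
  \sum_i \sum_j v i * v j / (e i + e j).

(** One step of Gaussian elimination: with p = [e ord0], the Schur complement of a Cauchy matrix is
    again a scaled Cauchy matrix, because (x + p) (y + p) - 2 p (x + y) = (x - p) (y - p). *)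
Lemma cauchy_form_recl n (e v : 'I_n.+1 -> R) : (forall i, 0 < e i) ->
  cauchy_form e v = 2 * e ord0 * (\sum_i v i / (e i + e ord0)) ^+ 2 +
    cauchy_form (fun i => e (lift ord0 i))
      (fun i => v (lift ord0 i) * (e (lift ord0 i) - e ord0) /
                (e (lift ord0 i) + e ord0)).
Proof.
move=> e0; pose v' i := v i * (e i - e ord0) / (e i + e ord0).
have v'0 : v' ord0 = 0 by rewrite /v' subrr mulr0 mul0r.
have -> : cauchy_form (fun i => e (lift ord0 i)) (fun i => v' (lift ord0 i)) =
    \sum_i \sum_j v' i * v' j / (e i + e j).
  rewrite big_ord_recl [X in _ = X + _]big1 ?add0r; last first.
    by move=> j _; rewrite v'0 !mul0r.
  by apply: eq_bigr => i _; rewrite [RHS]big_ord_recl v'0 mulr0 mul0r add0r.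
rewrite expr2 mulr_suml mulr_sumr -big_split /=; apply: eq_bigr => i _.
rewrite !mulr_sumr -big_split /=; apply: eq_bigr => j _; rewrite /v'.
have ei := e0 i; have ej := e0 j; have e00 := e0 ord0.
by field; rewrite ?gt_eqF ?addr_gt0.
Qed.

Lemma cauchy_form_ge0 n (e v : 'I_n -> R) :
  (forall i, 0 < e i) -> 0 <= cauchy_form e v.
Proof.
elim: n e v => [|n IHn] e v e0; first by rewrite /cauchy_form big_ord0.
by rewrite cauchy_form_recl// addr_ge0 ?IHn// mulr_ge0 ?sqr_ge0 ?mulr_ge0 ?ltW.
Qed.

(** Both summands of the elimination step vanish. By induction the second one kills every
    [v (lift ord0 i)], as the factors [e (lift ord0 i) - e ord0] are nonzero; the square then
    reduces to its [ord0] term. *)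
Lemma cauchy_form_eq0 n (e v : 'I_n -> R) : (forall i, 0 < e i) ->
  injective e -> cauchy_form e v = 0 -> forall i, v i = 0.
Proof.
elim: n e v => [|n IHn] e v e0 einj; first by move=> _ [].
rewrite cauchy_form_recl// => /eqP; rewrite paddr_eq0; last 2 first.
- by rewrite mulr_ge0 ?sqr_ge0 ?mulr_ge0 ?ltW.
- exact: cauchy_form_ge0.
case/andP=> /eqP s0 /eqP v0.
have vS i : v (lift ord0 i) = 0.
  have ind : injective (fun i => e (lift ord0 i)) by move=> j k /einj/lift_inj.
  have /eqP := IHn _ _ (fun i => e0 _) ind v0 i.
  rewrite !mulf_eq0 invr_eq0 [X in _ || X]gt_eqF ?addr_gt0// orbF => /orP[/eqP//|].
  by rewrite subr_eq0 => /eqP/einj/eqP; rewrite eq_sym (negbTE (neq_lift _ _)).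
move=> i; case: (unliftP ord0 i) => [j|] ->; first exact: vS.
move: s0 => /eqP; rewrite big_ord_recl big1 ?addr0; last first.
  by move=> j _; rewrite vS mul0r.
rewrite mulf_eq0 sqrf_eq0 (gt_eqF (mulr_gt0 _ _))//= mulf_eq0 invr_eq0.
by rewrite (gt_eqF (addr_gt0 _ _))// orbF => /eqP.
Qed.

End CauchyForm.

(** * Dot product of column vectors *)

Section DotProduct.
Context {R : comRingType} {n : nat}.
Implicit Types (u v w : 'cV[R]_n) (A : 'M[R]_n).

Lemma coordD u v i : (u + v) i 0 = u i 0 + v i 0. Proof. exact: mxE. Qed.

Lemma coordN u i : (- u) i 0 = - u i 0. Proof. exact: mxE. Qed.

Lemma coordZ c u i : (c *: u) i 0 = c * u i 0. Proof. exact: mxE. Qed.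

Definition coordE := (coordD, coordN, coordZ).

Definition dotv u v : R := \sum_i u i 0 * v i 0.

Lemma dotvC u v : dotv u v = dotv v u.
Proof. by apply: eq_bigr => i _; rewrite mulrC. Qed.

Lemma dotvDr u v w : dotv u (v + w) = dotv u v + dotv u w.
Proof. by rewrite -big_split; apply: eq_bigr => i _; rewrite mxE mulrDr. Qed.

Lemma dotvZr c u v : dotv u (c *: v) = c * dotv u v.
Proof. by rewrite mulr_sumr; apply: eq_bigr => i _; rewrite mxE mulrCA. Qed.

Lemma dotvBr u v w : dotv u (v - w) = dotv u v - dotv u w.
Proof. by rewrite dotvDr -scaleN1r dotvZr mulN1r. Qed.

Lemma dotv_mulmx u v : u^T *m v = (dotv u v)%:M.
Proof.
apply/matrixP => i j; rewrite !mxE !ord1 eqxx mulr1n.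
by apply: eq_bigr => k _; rewrite mxE.
Qed.

Lemma dotv_mulmxr A u v : dotv u (A *m v) = dotv (A^T *m u) v.
Proof.
have /matrixP/(_ 0 0) : u^T *m (A *m v) = (A^T *m u)^T *m v.
  by rewrite trmx_mul trmxK mulmxA.
by rewrite !dotv_mulmx !mxE.
Qed.

Lemma mul_outer u v w : u *m v^T *m w = dotv v w *: u.
Proof. by rewrite -mulmxA dotv_mulmx mul_mx_scalar. Qed.

End DotProduct.

(** * Algebra of the matrix 2 Lam + K *)

Section SolitonMatrix.
Context {R : realFieldType} {N : nat} (e : 'I_N -> R).
Implicit Types (z v b : 'cV[R]_N).

Definition Dmx b : 'M[R]_N := diag_mx b^T.

Definition Lam : 'M[R]_N := Dmx (\col_i e i).

Definition Kmx z : 'M[R]_N := \matrix_(j, k) (z j 0 * z k 0 / (e j + e k)).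

Definition Amx z : 'M[R]_N := 2 *: Lam + Kmx z.

(* For z_j = a_j exp(e_j x) the soliton is U = 2 Lam y with y = [ysol z].
   [ysol1] is y', [phisol b] is the derivative of y in the direction D_b z of z
   (that is, along a_j |-> (1 + t b_j) a_j), and [phisol1 b] is its x-derivative. *)
Definition ysol z : 'cV[R]_N := invmx (Amx z) *m z.

Definition ysol1 z : 'cV[R]_N :=
  4 *: (invmx (Amx z) *m (Lam *m (Lam *m ysol z))) - Lam *m ysol z.

Definition Qsol z : R := 4 * dotv (ysol z) (Lam *m (Lam *m ysol z)).

Definition rsol b z : 'cV[R]_N :=
  4 *: (invmx (Amx z) *m (Dmx b *m (Lam *m ysol z))).

Definition rsol1 b z : 'cV[R]_N :=
  4 *: (invmx (Amx z) *m (Dmx b *m (Lam *m ysol1 z)))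
  - dotv z (rsol b z) *: ysol z.

Definition phisol b z : 'cV[R]_N := rsol b z - Dmx b *m ysol z.

Definition phisol1 b z : 'cV[R]_N := rsol1 b z - Dmx b *m ysol1 z.

Lemma DmxE b v i : (Dmx b *m v) i 0 = b i 0 * v i 0.
Proof. by rewrite mul_diag_mx !mxE. Qed.

Lemma LamE v i : (Lam *m v) i 0 = e i * v i 0.
Proof. by rewrite DmxE mxE. Qed.

Lemma tr_Dmx b : (Dmx b)^T = Dmx b.
Proof. exact: tr_diag_mx. Qed.

Lemma DmxC b b' : Dmx b *m Dmx b' = Dmx b' *m Dmx b.
Proof. exact: diag_mxC. Qed.

Lemma Lam_Dmx b v : Lam *m (Dmx b *m v) = Dmx b *m (Lam *m v).
Proof. by rewrite !mulmxA DmxC. Qed.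

Lemma tr_Amx z : (Amx z)^T = Amx z.
Proof.
rewrite linearD/= linearZ/= tr_Dmx; congr (_ + _).
by apply/matrixP => i j; rewrite !mxE [e j + _]addrC [z j 0 * _]mulrC.
Qed.

Lemma tr_invAmx z : (invmx (Amx z))^T = invmx (Amx z).
Proof. by rewrite trmx_inv tr_Amx. Qed.

Lemma KmxE z v i : (Kmx z *m v) i 0 =
  \sum_j z i 0 * z j 0 / (e i + e j) * v j 0.
Proof. by rewrite mxE; apply: eq_bigr => j _; rewrite mxE. Qed.

Lemma AmxE z v i : (Amx z *m v) i 0 =
  2 * (e i * v i 0) + \sum_j z i 0 * z j 0 / (e i + e j) * v j 0.
Proof. by rewrite mulmxDl mxE -scalemxAl mxE LamE KmxE. Qed.

Hypothesis e0 : forall i, 0 < e i.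

Lemma dotv_Kmx_ge0 z v : 0 <= dotv v (Kmx z *m v).
Proof.
have := @cauchy_form_ge0 _ _ e (fun i => v i 0 * z i 0) e0.
congr (0 <= _); rewrite /cauchy_form /dotv; apply: eq_bigr => i _.
rewrite KmxE mulr_sumr; apply: eq_bigr => j _.
by field; rewrite gt_eqF ?addr_gt0.
Qed.

Lemma dotv_Amx_ge z v : 2 * dotv v (Lam *m v) <= dotv v (Amx z *m v).
Proof.
by rewrite mulmxDl -scalemxAl dotvDr dotvZr lerDl dotv_Kmx_ge0.
Qed.

Lemma dotv_Lam_ge d v : (forall i, d <= e i) ->
  d * dotv v v <= dotv v (Lam *m v).
Proof.
move=> de; rewrite mulr_sumr; apply: ler_sum => i _.
by rewrite LamE [leRHS]mulrCA -!expr2 ler_wpM2r ?sqr_ge0.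
Qed.

Lemma dotvv_ge0 v : 0 <= dotv v v.
Proof. by apply: sumr_ge0 => i _; rewrite -expr2 sqr_ge0. Qed.

Lemma dotvv_sqr_le v i : v i 0 ^+ 2 <= dotv v v.
Proof.
rewrite /dotv (bigD1 i)//= expr2 lerDl sumr_ge0// => j _.
by rewrite -expr2 sqr_ge0.
Qed.

Lemma Amx_inj0 z v : Amx z *m v = 0 -> v = 0.
Proof.
move=> Av0; have := dotv_Amx_ge z v; rewrite Av0.
rewrite [leRHS]/dotv big1 => [|i _]; last by rewrite mxE mulr0.
rewrite pmulr_rle0// => h; apply/colP => i; rewrite mxE; apply/eqP.
have : \sum_i e i * v i 0 ^+ 2 = 0.
  apply/eqP; rewrite eq_le sumr_ge0 ?andbT => [|j _]; last first.
    by rewrite mulr_ge0 ?sqr_ge0 ?ltW.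
  by rewrite (le_trans _ h)// ler_sum// => j _; rewrite LamE expr2 [leRHS]mulrCA.
move/psumr_eq0P => /(_ _ i isT)/eqP; rewrite mulf_eq0 gt_eqF//= sqrf_eq0; apply.
by move=> j _; rewrite mulr_ge0 ?sqr_ge0 ?ltW.
Qed.

Lemma Amx_unit z : Amx z \in unitmx.
Proof.
rewrite -row_free_unit; apply/inj_row_free => v vA.
apply: trmx_inj; rewrite trmx0; apply: (@Amx_inj0 z).
by rewrite -tr_Amx -trmx_mul vA trmx0.
Qed.

Lemma Amx_inj z u v : Amx z *m u = Amx z *m v -> u = v.
Proof. exact: can_inj (mulKmx (Amx_unit z)) _ _. Qed.

Lemma invAmxK z v : Amx z *m (invmx (Amx z) *m v) = v.
Proof. exact: mulKVmx (Amx_unit z) _. Qed.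

Lemma Amx_ysol z : Amx z *m ysol z = z.
Proof. exact: invAmxK. Qed.

Lemma Amx_rsol b z : Amx z *m rsol b z = 4 *: (Dmx b *m (Lam *m ysol z)).
Proof. by rewrite -scalemxAr invAmxK. Qed.

Lemma dotv_Amx z u v : dotv u (Amx z *m v) = dotv (Amx z *m u) v.
Proof. by rewrite dotv_mulmxr tr_Amx. Qed.

Lemma dotv_Dmx b u v : dotv u (Dmx b *m v) = dotv (Dmx b *m u) v.
Proof. by rewrite dotv_mulmxr tr_Dmx. Qed.

Lemma dotv_Lam u v : dotv u (Lam *m v) = dotv (Lam *m u) v.
Proof. exact: dotv_Dmx. Qed.

Lemma dotv_z z v : dotv z v = dotv (ysol z) (Amx z *m v).
Proof. by rewrite dotv_Amx Amx_ysol. Qed.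

(* The Cauchy structure of K makes Lam K + K Lam the rank-one matrix z z^T. *)
Lemma Amx_Lam z v : Amx z *m (Lam *m v) =
  4 *: (Lam *m (Lam *m v)) + dotv z v *: z - Lam *m (Amx z *m v).
Proof.
apply/colP => i; rewrite AmxE !coordE.
rewrite !LamE AmxE mulrDr opprD addrA.
suff -> : dotv z v * z i 0 = \sum_j z i 0 * z j 0 / (e i + e j) * (Lam *m v) j 0
   + e i * \sum_j z i 0 * z j 0 / (e i + e j) * v j 0 by ring.
rewrite mulr_sumr -big_split mulr_suml; apply: eq_bigr => j _ /=.
by rewrite LamE; field; rewrite gt_eqF ?addr_gt0.
Qed.

(** This is A y = z differentiated in x, with A' = z z^T and z' = Lam z. It is obtained here from
    the closed form of [ysol1] by pure algebra. *)
Lemma Amx_ysol1 z :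
  Amx z *m ysol1 z = Lam *m z - dotv z (ysol z) *: z.
Proof.
rewrite mulmxBr -scalemxAr invAmxK Amx_Lam Amx_ysol.
by apply/colP => i; rewrite !(LamE, coordE); ring.
Qed.

Lemma dotv_z_ysol1 z : dotv z (ysol1 z) = Qsol z - dotv z (Lam *m ysol z).
Proof. by rewrite dotvBr dotvZr [in LHS](dotv_z z (invmx _ *m _)) invAmxK. Qed.

(** The left side is what the product rule gives for the derivative of [ysol1]; the right side turns
    it into y'' = Lam^2 y - 2 Q y. Since U = 2 Lam y and Q is the sum of the U_k^2, this is the
    soliton equation. *)
Lemma ysol1_deriv z :
  4 *: (invmx (Amx z) *m (Lam *m (Lam *m ysol1 z))) - Qsol z *: ysol z
  - Lam *m ysol1 z =
  Lam *m (Lam *m ysol z) - (2 * Qsol z) *: ysol z.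
Proof.
move: (ysol1 z) (Amx_ysol1 z) (dotv_z_ysol1 z) => y1 Ay1 zy1.
apply: (@Amx_inj z); rewrite !mulmxBr -!scalemxAr invAmxK !Amx_Lam.
rewrite Ay1 Amx_ysol zy1.
by apply/colP => i; rewrite !(LamE, coordE); ring.
Qed.

Lemma dotv_z_rsol b z : dotv z (rsol b z) = 4 * dotv (ysol z) (Dmx b *m (Lam *m ysol z)).
Proof. by rewrite dotv_z Amx_rsol dotvZr. Qed.

Lemma dotv_rsol b z v : dotv (rsol b z) v =
  4 * dotv (ysol z) (Dmx b *m (Lam *m (invmx (Amx z) *m v))).
Proof.
rewrite dotvC dotvZr dotv_mulmxr tr_invAmx dotvC -dotv_Dmx -dotv_Lam.
by rewrite Lam_Dmx.
Qed.

(** The linearized equation for phi = [phisol b z], again with the raw product rule on the left. The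
    coefficient 4 comes from (A^-1)' = - y y^T, the 8 from the derivative of the quadratic form
    [dotv z (rsol b z)]. On the right, 16 is the 4 of the linearized operator times the 4 in U . (2
    Lam phi) = 4 y . Lam^2 phi. *)
Lemma phisol1_deriv b z (y := ysol z) (y1 := ysol1 z) :
  4 *: (invmx (Amx z) *m (Dmx b *m (Lam *m (Lam *m (Lam *m y) - (2 * Qsol z) *: y))))
  - (4 * dotv y (Dmx b *m (Lam *m y1))) *: y
  - (8 * dotv y (Dmx b *m (Lam *m y1))) *: y - dotv z (rsol b z) *: y1
  - Dmx b *m (Lam *m (Lam *m y) - (2 * Qsol z) *: y) =
  Lam *m (Lam *m phisol b z) - (2 * Qsol z) *: phisol b z
  - (16 * dotv y (Lam *m (Lam *m phisol b z))) *: y.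
Proof.
(* The scalar in y' is traded for one in r = [rsol b z]: both contain the same entry of the
   symmetric A^-1, between D_b Lam y and Lam^2 y. *)
have beta : dotv y (Dmx b *m (Lam *m y1)) =
    dotv y (Lam *m (Lam *m (rsol b z))) - dotv y (Dmx b *m (Lam *m (Lam *m y))).
  rewrite [X in _ = X - _]dotvC -!dotv_Lam dotv_rsol /y1 /ysol1 !mulmxBr.
  by rewrite dotvBr -!scalemxAr dotvZr.
rewrite beta /phisol -/y; have Ay1 : Amx z *m y1 = _ := Amx_ysol1 z.
have Ay : Amx z *m y = z := Amx_ysol z.
move: y1 (rsol b z) beta Ay1 (Amx_rsol b z) => y1 r _ Ay1; rewrite -/y => Ar.
(* Applying A to Lam^2 r produces this scalar; writing z = A y and commuting Lam past A expresses it
   through scalars already present. *)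
have zLr : dotv z (Lam *m r) = 4 * dotv y (Lam *m (Lam *m r)) +
   dotv z y * dotv z r - 4 * dotv y (Lam *m (Dmx b *m (Lam *m y))).
  rewrite dotv_z Amx_Lam dotvBr dotvDr !dotvZr -/y Ar -scalemxAr dotvZr.
  by rewrite [dotv y z]dotvC; ring.
rewrite -!(Lam_Dmx b) in Ar zLr *; apply: (@Amx_inj z).
rewrite !mulmxBr -!scalemxAr !mulmxBr -!scalemxAr !invAmxK -!(Lam_Dmx b).
rewrite !Amx_Lam -/y.
rewrite Ay1 ?Ay Ar zLr !dotvBr -/y.
apply/colP => i; rewrite !(LamE, DmxE, coordE). ring.
Qed.

(** The right side is the derivative of A^-1 z when z moves by D_b z, since K then moves by D_b K +
    K D_b. The closed form follows from D_b K + K D_b = D_b A + A D_b - 4 D_b Lam. *)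
Lemma phisolE b z : phisol b z = invmx (Amx z) *m (Dmx b *m z) -
  invmx (Amx z) *m ((Dmx b *m Kmx z + Kmx z *m Dmx b) *m ysol z).
Proof.
have KE v : Kmx z *m v = Amx z *m v - 2 *: (Lam *m v).
  by rewrite mulmxDl -scalemxAl addrC addKr.
apply: (@Amx_inj z); rewrite !mulmxBr !invAmxK Amx_rsol mulmxDl -!mulmxA !KE.
by rewrite Amx_ysol; apply/colP => i; rewrite !(LamE, DmxE, coordE); ring.
Qed.

Lemma ysol_Kmx z u : Kmx z *m u = z ->
  ysol z = u - 2 *: (invmx (Amx z) *m (Lam *m u)).
Proof.
move=> Ku; apply: (@Amx_inj z); rewrite Amx_ysol mulmxBr -scalemxAr invAmxK.
by rewrite mulmxDl -scalemxAl Ku addrC addKr.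
Qed.

Lemma phisol_eq0 b z : phisol b z = 0 ->
  Dmx b *m z = Dmx b *m (Kmx z *m ysol z) + Kmx z *m (Dmx b *m ysol z).
Proof.
rewrite phisolE -mulmxBr => /(congr1 (mulmx (Amx z))).
rewrite invAmxK mulmx0 => /eqP; rewrite subr_eq0 => /eqP ->.
by rewrite mulmxDl !mulmxA.
Qed.

(** As K is nonnegative, A is bounded below by 2 d whatever z is; the bound (2 d)^-1 on the inverse
    is thus uniform in x. *)
Lemma invAmx_bound d z v : 0 < d -> (forall i, d <= e i) ->
  dotv (invmx (Amx z) *m v) (invmx (Amx z) *m v) <= (4 * d ^+ 2)^-1 * dotv v v.
Proof.
move=> d0 de; set w := invmx _ *m v.
have Aw : Amx z *m w = v by rewrite invAmxK.
have wv : 2 * d * dotv w w <= dotv w v.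
  rewrite -Aw (le_trans _ (dotv_Amx_ge z w))// -mulrA ler_pM2l//.
  exact: dotv_Lam_ge.
(* This replaces Cauchy-Schwarz: v.v >= 4 d w.v - 4 d^2 w.w, and 4 d w.v >= 8 d^2 w.w by
   coercivity. *)
have : 0 <= dotv (v - (2 * d) *: w) (v - (2 * d) *: w) by exact: dotvv_ge0.
rewrite dotvBr dotvZr ![dotv (v - _) _]dotvC !dotvBr !dotvZr [dotv v w]dotvC.
rewrite [X in _ -> _ <= X]mulrC ler_pdivlMr ?mulr_gt0 ?exprn_gt0//.
have := dotvv_ge0 w; move: (dotv w w) (dotv w v) (dotv v v) wv => x y t; nra.
Qed.

End SolitonMatrix.

(** * From the determinant formula to U = 2 Lam y *)

Section DeterminantFormula.
Context {R : realType} {N : nat}.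
Implicit Types (mu : 'I_N -> R) (a : 'rV[R]_N).

(** The same block matrix is factored by eliminating either of its diagonal blocks, and the two
    determinants are compared. *)
Lemma det_sub_outer n (u v : 'cV[R]_n) :
  \det (1%:M - u *m v^T) = 1 - dotv v u.
Proof.
have E1 : block_mx (1%:M : 'M[R]_1) v^T u 1%:M =
    block_mx (1%:M : 'M[R]_1) 0 u 1%:M *m block_mx 1%:M v^T 0 (1%:M - u *m v^T).
  by rewrite mulmx_block !(mulmx1, mul1mx, mul0mx, mulmx0, addr0) [_ + (_ - _)]addrC subrK.
have E2 : block_mx (1%:M : 'M[R]_1) v^T u 1%:M =
    block_mx (1%:M : 'M[R]_1) v^T 0 1%:M *m block_mx (1%:M - v^T *m u) 0 u 1%:M.
  by rewrite mulmx_block !(mulmx1, mul1mx, mul0mx, mulmx0, add0r) subrK.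
have := congr1 determinant E2; rewrite {}E1 !det_mulmx !det_lblock !det_ublock.
rewrite !det1 !mul1r !mulr1 => ->.
by rewrite dotv_mulmx det_mx11 !mxE eqxx.
Qed.

Definition zvec mu a (x : R) : 'cV[R]_N :=
  \col_j (a 0 j * expR (eta mu j * x)).

Lemma Usol_ysol mu a i x : (forall j, mu j < 0) ->
  Usol mu a i x = 2 * eta mu i * ysol (eta mu) (zvec mu a x) i 0.
Proof.
move=> mu0; set e := eta mu; set z := zvec mu a x.
have e0 j : 0 < e j by rewrite sqrtr_gt0 oppr_gt0.
(* With S = diag(s), the normalisation in [Mmat] makes S (I + M) S equal to 2 Lam + K. *)
pose s : 'cV[R]_N := \col_j Num.sqrt (2 * e j).
pose G := 1%:M + Mmat mu a x; pose S := Dmx s.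
have s0 j : s j 0 != 0 by rewrite mxE gt_eqF// sqrtr_gt0 mulr_gt0.
pose w : 'cV[R]_N := \col_j (z j 0 / s j 0).
have wE j : w j 0 = z j 0 / s j 0 by rewrite mxE.
have Sw : S *m w = z by apply/colP => j; rewrite DmxE wE mulrCA divff ?mulr1.
have s2 j : s j 0 * s j 0 = 2 * e j.
  by rewrite -expr2 mxE sqr_sqrtr// ltW// mulr_gt0.
have ejk j k : e j + e k != 0 by rewrite gt_eqF ?addr_gt0.
have ME j k : Mmat mu a x j k = w j 0 * w k 0 / (e j + e k).
  rewrite !wE [LHS]mxE -/(e j) -/(e k) [(_ + _) * x]mulrDl expRD ![z _ _]mxE -/(e j) -/(e k).
  have -> : 2 * Num.sqrt (e j * e k) = s j 0 * s k 0.
    rewrite !mxE; move: (e0 j) (e0 k); move: (e j) (e k) => p q p0 q0.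
    rewrite -sqrtrM ?mulr_ge0 ?ltW//.
    rewrite (_ : 2 * p * (2 * q) = 2 ^+ 2 * (p * q)); last by ring.
    by rewrite [RHS]sqrtrM ?exprn_ge0// sqrtr_sqr ger0_norm.
  by field; rewrite ejk !s0.
have AE : Amx e z = S *m G *m S.
  apply/matrixP => j k; transitivity (s j 0 * G j k * s k 0); last first.
    by rewrite mul_mx_diag mul_diag_mx [RHS]mxE [X in _ = X * _]mxE ![s^T _ _]mxE.
  rewrite [LHS]mxE [X in X + _]mxE [X in _ + X]mxE [Lam e j k]mxE.
  rewrite [(_^T) _ _]mxE [(\col_i _) _ _]mxE [G j k]mxE ME !wE mulrDr mulrDl [1%:M j k]mxE.
  congr (_ + _); last by field; rewrite ejk !s0.
  case: eqP => [<-|_]; last by rewrite /= ?mulr0n !(mulr0, mul0r).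
  by rewrite !mulr1n -s2 mulr1.
have S_inj (u v : 'cV[R]_N) : S *m u = S *m v -> u = v.
  move=> Suv; apply/colP => j; have /colP/(_ j) := Suv.
  by rewrite !DmxE => /(mulfI (s0 j)).
have G_unit : G \in unitmx.
  have := Amx_unit e0 z; rewrite AE !unitmxE !det_mulmx !unitfE !mulf_eq0.
  by rewrite !negb_or => /andP[/andP[]].
have Gpsi : G *m (S *m ysol e z) = w.
  by apply: S_inj; rewrite Sw -[RHS](Amx_ysol e0) AE -!mulmxA.
pose v : 'cV[R]_N := \col_k (w k 0 / (e i + e k)).
pose T : 'cV[R]_N := \col_j (e i + e j).
(* With T = diag(e_i + e_j), one has T (I + B M) = (G - w v^T) T: entrywise, M_jk (e_i + e_k) - w_j
   w_k = M_jk (e_i - e_j). So the numerator is a rank-one perturbation of the denominator. *)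
have detY : \det (1%:M + Bmat mu i *m Mmat mu a x) = \det (G - w *m v^T).
  have detT : \det (Dmx T) != 0.
    by rewrite det_diag; apply/prodf_neq0 => j _; rewrite !mxE gt_eqF// addr_gt0.
  apply: (mulfI detT); rewrite [RHS]mulrC -!det_mulmx; congr (\det _).
  have TE j : T j 0 = e i + e j by rewrite mxE.
  have vE j : v j 0 = w j 0 / (e i + e j) by rewrite mxE.
  have GE j k : G j k = (j == k)%:R + Mmat mu a x j k.
    by rewrite mxE [1%:M j k]mxE.
  apply/matrixP => j k.
  transitivity (T j 0 * ((j == k)%:R + (e i - e j) / (e i + e j) * Mmat mu a x j k)).
    rewrite mul_diag_mx [LHS]mxE [T^T _ _]mxE; congr (_ * _).
    rewrite [LHS]mxE [1%:M j k]mxE mul_diag_mx; congr (_ + _).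
    by rewrite [LHS]mxE; congr (_ * _); rewrite mxE.
  transitivity ((G j k - w j 0 * v k 0) * T k 0); last first.
    rewrite mul_mx_diag [RHS]mxE [T^T _ _]mxE; congr (_ * _).
    rewrite [RHS]mxE; congr (_ + _); rewrite [RHS]mxE; congr (- _).
    by rewrite [RHS]mxE big_ord1 [v^T _ _]mxE.
  rewrite GE !TE vE ME; case: (eqVneq j k) => [<-|_] /=; rewrite ?(mulr1n, mulr0n).
    by field; rewrite !ejk.
  by field; rewrite !ejk.
rewrite /Usol detY -/G.
have -> : G - w *m v^T = G *m (1%:M - (S *m ysol e z) *m v^T).
  by rewrite mulmxBr mulmx1 [G *m (_ *m _)]mulmxA Gpsi.
have detG : \det G != 0 by rewrite -unitfE -unitmxE.
rewrite det_mulmx det_sub_outer mulrCA mulrAC mulfV// mul1r.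
have -> : a 0 i * expR (eta mu i * x) = z i 0 by rewrite mxE.
(* After cancelling det G, what remains is z_i - (K y)_i, which row i of (2 Lam + K) y = z
   identifies with 2 e_i y_i. *)
have /colP/(_ i) := Amx_ysol e0 z; rewrite AmxE => zE.
rewrite mulrBr mulr1 -[X in X - _ = _]zE mulrA -[RHS]addr0 -addrA; congr (_ + _).
apply/eqP; rewrite subr_eq0 mulr_sumr; apply/eqP; apply: eq_bigr => j _.
rewrite DmxE [v j 0]mxE wE; field; rewrite ejk s0//.
Qed.

End DeterminantFormula.

(** * Entrywise differentiation of matrices *)

Section MatrixDerivative.
Context {R : realType}.
Implicit Types (x : R).

Lemma derivable_bigsum (I : Type) (r : seq I) (P : pred I) (f : I -> R -> R) x :
  (forall i, derivable (f i) x 1) ->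
  derivable (fun t => \sum_(i <- r | P i) f i t) x 1.
Proof.
move=> fx; elim: r => [|i r IHr].
  by under [X in derivable X]eq_fun do rewrite big_nil; exact: derivable_cst.
under [X in derivable X]eq_fun do rewrite big_cons.
case: (P i); last exact: IHr.
exact: (derivableD (fx i) IHr).
Qed.

Lemma derivable_bigprod (I : Type) (r : seq I) (P : pred I) (f : I -> R -> R) x :
  (forall i, derivable (f i) x 1) ->
  derivable (fun t => \prod_(i <- r | P i) f i t) x 1.
Proof.
move=> fx; elim: r => [|i r IHr].
  by under [X in derivable X]eq_fun do rewrite big_nil; exact: derivable_cst.
under [X in derivable X]eq_fun do rewrite big_cons.
case: (P i); last exact: IHr.
exact: (derivableM (fx i) IHr).
Qed.

Lemma is_derive_bigsum n (f : 'I_n -> R -> R) (f' : 'I_n -> R) x :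
  (forall i, is_derive x (1 : R) (f i) (f' i)) ->
  is_derive x (1 : R) (fun t => \sum_i f i t) (\sum_i f' i).
Proof.
move=> fx; rewrite (_ : (fun t => _) = \sum_i f i); last first.
  by apply/funext => t; rewrite fct_sumE.
exact: is_derive_sum.
Qed.

Lemma derivable_det n (F : R -> 'M[R]_n) x :
  (forall i j, derivable (fun t => F t i j) x 1) ->
  derivable (fun t => \det (F t)) x 1.
Proof.
move=> Fx; apply: derivable_bigsum => s; apply: derivableM.
  exact: derivable_cst.
exact: derivable_bigprod.
Qed.

Definition mx_derive m n (F : R -> 'M[R]_(m, n)) x (F' : 'M[R]_(m, n)) :=
  forall i j, is_derive x (1 : R) (fun t => F t i j) (F' i j).

Lemma mx_derive_cst m n (A : 'M[R]_(m, n)) x : mx_derive (fun=> A) x 0.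
Proof. by move=> i j; rewrite mxE; exact: is_derive_cst. Qed.

Lemma mx_deriveD m n (F G : R -> 'M[R]_(m, n)) x F' G' :
  mx_derive F x F' -> mx_derive G x G' ->
  mx_derive (fun t => F t + G t) x (F' + G').
Proof.
move=> dF dG i j; rewrite mxE; under eq_fun do rewrite mxE.
exact: is_deriveD.
Qed.

Lemma mx_deriveB m n (F G : R -> 'M[R]_(m, n)) x F' G' :
  mx_derive F x F' -> mx_derive G x G' ->
  mx_derive (fun t => F t - G t) x (F' - G').
Proof.
move=> dF dG i j; rewrite !mxE; under eq_fun do rewrite !mxE.
exact: is_deriveB.
Qed.

Lemma mx_deriveZ m n (f : R -> R) (F : R -> 'M[R]_(m, n)) x f' F' :
  is_derive x (1 : R) f f' -> mx_derive F x F' ->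
  mx_derive (fun t => f t *: F t) x (f' *: F x + f x *: F').
Proof.
move=> df dF i j; rewrite !mxE; under eq_fun do rewrite mxE.
apply: is_derive_eq; first exact: (@is_deriveM _ _ f (fun t => F t i j)).
by rewrite /GRing.scale/=; ring.
Qed.

Lemma mx_deriveZl m n c (F : R -> 'M[R]_(m, n)) x F' :
  mx_derive F x F' -> mx_derive (fun t => c *: F t) x (c *: F').
Proof.
by move=> /(mx_deriveZ (is_derive_cst c x 1)); rewrite scale0r add0r.
Qed.

Lemma mx_deriveM m n p (F : R -> 'M[R]_(m, n)) (G : R -> 'M[R]_(n, p)) x F' G' :
  mx_derive F x F' -> mx_derive G x G' ->
  mx_derive (fun t => F t *m G t) x (F' *m G x + F x *m G').
Proof.
move=> dF dG i j; rewrite !mxE -big_split/=; under eq_fun do rewrite mxE.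
apply: is_derive_bigsum => k.
apply: is_derive_eq; first exact: (@is_deriveM _ _ (fun t => F t i k)).
by rewrite /GRing.scale/=; ring.
Qed.

Lemma mx_deriveMl m n p (A : 'M[R]_(m, n)) (G : R -> 'M[R]_(n, p)) x G' :
  mx_derive G x G' -> mx_derive (fun t => A *m G t) x (A *m G').
Proof.
by move=> /(mx_deriveM (mx_derive_cst A x)); rewrite mul0mx add0r.
Qed.

Lemma mx_derive_sum m n p (F : 'I_p -> R -> 'M[R]_(m, n)) x F' :
  (forall k, mx_derive (F k) x (F' k)) ->
  mx_derive (fun t => \sum_k F k t) x (\sum_k F' k).
Proof.
move=> dF i j; rewrite summxE; under eq_fun do rewrite summxE.
by apply: is_derive_bigsum => k; exact: dF.
Qed.

Lemma mx_derive_unique m n (F : R -> 'M[R]_(m, n)) x F1 F2 :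
  mx_derive F x F1 -> mx_derive F x F2 -> F1 = F2.
Proof.
move=> d1 d2; apply/matrixP => i j.
by have [_ <-] := d1 i j; have [_ <-] := d2 i j.
Qed.

(** Differentiability comes from the cofactor formula for the inverse; the value is then forced by
    differentiating F F^-1 = I. *)
Lemma mx_derive_inv n (F : R -> 'M[R]_n) x F' :
  (forall t, F t \in unitmx) -> mx_derive F x F' ->
  mx_derive (fun t => invmx (F t)) x (- (invmx (F x) *m F' *m invmx (F x))).
Proof.
move=> Fu dF.
have [G dG] : exists G, mx_derive (fun t => invmx (F t)) x G.
  have der i j : derivable (fun t => invmx (F t) i j) x 1.
    under [X in derivable X]eq_fun do rewrite /invmx Fu !mxE.
    have dFE k l : derivable (fun t => F t k l) x 1 by have [] := dF k l.
    apply: derivableM.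
      apply: derivableV; last exact: derivable_det.
      by rewrite /= -unitfE -unitmxE Fu.
    apply: derivableM; first exact: derivable_cst.
    apply: derivable_det => k l.
    by under [X in derivable X]eq_fun do rewrite !mxE; exact: dFE.
  exists (\matrix_(i, j) 'D_1 (fun t => invmx (F t) i j) x) => i j.
  by rewrite mxE; apply/derivableP.
suff <- : G = - (invmx (F x) *m F' *m invmx (F x)) by [].
have := mx_deriveM dF dG; rewrite (_ : (fun t => _) = fun=> 1%:M); last first.
  by apply/funext => t; rewrite mulmxV.
move=> /mx_derive_unique/(_ (mx_derive_cst _ _))/(congr1 (mulmx (invmx (F x)))).
rewrite mulmx0 mulmxDr mulKmx// mulmxA => /eqP.
by rewrite addrC addr_eq0 => /eqP.
Qed.

Lemma is_derive_dotv n (u v : R -> 'cV[R]_n) x u' v' :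
  mx_derive u x u' -> mx_derive v x v' ->
  is_derive x (1 : R) (fun t => dotv (u t) (v t)) (dotv u' (v x) + dotv (u x) v').
Proof.
move=> du dv; rewrite -big_split/=; apply: is_derive_bigsum => k.
apply: is_derive_eq; first exact: (@is_deriveM _ _ (fun t => u t k 0)).
by rewrite /GRing.scale/=; ring.
Qed.

End MatrixDerivative.

(** * Derivatives of y and of its variations *)

Section SolitonDerivatives.
Context {R : realType} {N : nat} (e : 'I_N -> R).
Hypothesis e0 : forall i, 0 < e i.
Implicit Types (x : R) (b : 'cV[R]_N) (z : R -> 'cV[R]_N).

(** The path [z] is arbitrary, so that b = eta yields the derivative in x and b = c / a the
    derivative in the parameter along c. *)
Lemma mx_derive_Amx z x b : mx_derive z x (Dmx b *m z x) ->
  mx_derive (fun t => Amx e (z t)) x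
    (Dmx b *m Kmx e (z x) + Kmx e (z x) *m Dmx b).
Proof.
move=> dz; rewrite -[X in mx_derive _ _ X]add0r; apply: mx_deriveD.
  exact: mx_derive_cst.
move=> i j; under eq_fun do rewrite mxE.
have dzi k : is_derive x (1 : R) (fun t => z t k 0) (b k 0 * z x k 0).
  by rewrite -DmxE.
apply: is_derive_eq.
rewrite [RHS]mxE mul_mx_diag mul_diag_mx ![in RHS]mxE /GRing.scale /=.
by ring.
Qed.

Lemma mx_derive_ysol z x b : mx_derive z x (Dmx b *m z x) ->
  mx_derive (fun t => ysol e (z t)) x (phisol e b (z x)).
Proof.
move=> dz; have dA := mx_derive_inv (fun t => Amx_unit e0 (z t)) (mx_derive_Amx dz).
have := mx_deriveM dA dz; rewrite phisolE// mulNmx addrC -!mulmxA.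
exact.
Qed.

Variable z : R -> 'cV[R]_N.
Hypothesis dz : forall x, mx_derive z x (Lam e *m z x).
Local Notation y x := (ysol e (z x)).

Lemma mx_derive_ysol_x x : mx_derive (fun t => y t) x (ysol1 e (z x)).
Proof. exact: mx_derive_ysol (dz x). Qed.

(** Here A' = Lam K + K Lam = z z^T, the Cauchy denominators cancelling; hence (A^-1)' = - (A^-1 z)
    (A^-1 z)^T. *)
Lemma mx_derive_invAmx x :
  mx_derive (fun t => invmx (Amx e (z t))) x (- (y x *m (y x)^T)).
Proof.
have := mx_derive_inv (fun t => Amx_unit e0 (z t)) (mx_derive_Amx (dz x)).
suff -> : Dmx (\col_i e i) *m Kmx e (z x) + Kmx e (z x) *m Dmx (\col_i e i) =
    z x *m (z x)^T by rewrite trmx_mul tr_invAmx !mulmxA.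
apply/matrixP => i j; rewrite mxE mul_mx_diag mul_diag_mx !mxE big_ord1 mxE.
by field; rewrite gt_eqF ?addr_gt0.
Qed.

(** The common shape of the leading terms of [ysol1] (b = eta, v = y), of [rsol] (v = y) and of
    [rsol1] (v = y'). *)
Lemma mx_derive_invAmxM b v v1 x : mx_derive v x v1 ->
  mx_derive (fun t => 4 *: (invmx (Amx e (z t)) *m (Dmx b *m (Lam e *m v t)))) x
   (4 *: (invmx (Amx e (z x)) *m (Dmx b *m (Lam e *m v1)))
    - (4 * dotv (y x) (Dmx b *m (Lam e *m v x))) *: y x).
Proof.
move=> dv; have dv' := mx_deriveMl (Dmx b) (mx_deriveMl (Lam e) dv).
have := mx_deriveZl 4 (mx_deriveM (mx_derive_invAmx x) dv').
by rewrite mulNmx mul_outer scalerDr scalerN scalerA addrC.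
Qed.

Lemma mx_derive_ysol1 x : mx_derive (fun t => ysol1 e (z t)) x
  (Lam e *m (Lam e *m y x) - (2 * Qsol e (z x)) *: y x).
Proof.
have dy := mx_derive_ysol_x x.
have := mx_deriveB (mx_derive_invAmxM (\col_i e i) dy) (mx_deriveMl (Lam e) dy).
by rewrite ysol1_deriv.
Qed.

Lemma mx_derive_rsol b x :
  mx_derive (fun t => rsol e b (z t)) x (rsol1 e b (z x)).
Proof.
have := mx_derive_invAmxM b (mx_derive_ysol_x x).
by rewrite -dotv_z_rsol.
Qed.

Lemma mx_derive_phisol b x :
  mx_derive (fun t => phisol e b (z t)) x (phisol1 e b (z x)).
Proof.
exact: mx_deriveB (mx_derive_rsol b x) (mx_deriveMl _ (mx_derive_ysol_x x)).
Qed.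

Lemma mx_derive_phisol1 b x :
  mx_derive (fun t => phisol1 e b (z t)) x
   (Lam e *m (Lam e *m phisol e b (z x)) - (2 * Qsol e (z x)) *: phisol e b (z x)
    - (16 * dotv (y x) (Lam e *m (Lam e *m phisol e b (z x)))) *: y x).
Proof.
rewrite -phisol1_deriv//; apply: mx_deriveB; last exact: mx_deriveMl (mx_derive_ysol1 x).
rewrite -addrA -opprD; apply: mx_deriveB.
  exact: mx_derive_invAmxM (mx_derive_ysol1 x).
apply: mx_deriveZ; last exact: mx_derive_ysol_x.
under eq_fun do rewrite dotv_z_rsol//.
have dy := mx_derive_ysol_x x.
have dBLy := mx_deriveMl (Dmx b) (mx_deriveMl (Lam e) dy).
apply: is_derive_eq.
  exact: (@is_deriveZ _ _ _ (fun t => dotv (y t) (Dmx b *m (Lam e *m y t))) 4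
    _ _ _ (is_derive_dotv dy dBLy)).
rewrite [dotv (ysol1 _ _) _]dotvC -dotv_Dmx -dotv_Lam Lam_Dmx /GRing.scale /=.
by ring.
Qed.

End SolitonDerivatives.

(** * Parameter derivatives of U in closed form *)

Section SolitonDecay.
Context {R : realType} {N : nat} (mu : 'I_N -> R) (a : 'rV[R]_N).
Hypothesis mu0 : forall i, mu i < 0.
Hypothesis mu_mono : forall i j : 'I_N, (i < j)%N -> mu i < mu j.
Hypothesis a0 : forall i, a 0 i != 0.
Local Notation e := (eta mu).
Local Notation z x := (zvec mu a x).

Lemma eta_gt0 i : 0 < e i.
Proof. by rewrite sqrtr_gt0 oppr_gt0. Qed.

Lemma eta_sqr i : e i ^+ 2 = - mu i.
Proof. by rewrite sqr_sqrtr// oppr_ge0 ltW. Qed.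

Lemma eta_inj : injective e.
Proof.
move=> i j eij; have muij : mu i = mu j.
  by apply: oppr_inj; rewrite -!eta_sqr eij.
have [ij|ji|/val_inj//] := ltngtP i j.
  by have := mu_mono ij; rewrite muij ltxx.
by have := mu_mono ji; rewrite muij ltxx.
Qed.

Lemma mx_derive_zvec x : mx_derive (zvec mu a) x (Lam e *m z x).
Proof.
move=> i j; rewrite ord1 LamE; under eq_fun do rewrite mxE.
rewrite mxE mulrCA; apply: is_derive_eq; rewrite /GRing.scale/=; ring.
Qed.

(** Along a + t c the entry z_j moves at relative speed c_j / a_j, which makes sense because a_j is
    nonzero. *)
Lemma Usol_dir (c : 'rV[R]_N) i x :
  is_derive (0 : R) (1 : R) (fun t => Usol mu (t *: c + a) i x)
   (2 * e i * phisol e (\col_j (c 0 j / a 0 j)) (z x) i 0).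
Proof.
have dz : mx_derive (fun t => zvec mu (t *: c + a) x) 0
    (Dmx (\col_j (c 0 j / a 0 j)) *m zvec mu (0 *: c + a) x).
  move=> j k; rewrite ord1 DmxE !mxE; under eq_fun do rewrite !mxE.
  rewrite mul0r add0r mulrA divfK//.
  rewrite (_ : (fun t => _) = (c 0 j * expR (e j * x)) \*: id +
      cst (a 0 j * expR (e j * x))); last first.
    by apply/funext => t; rewrite mulrDl [t * _]mulrC -mulrA [t * _]mulrC mulrA.
  have dZ := is_deriveZ (c 0 j * expR (e j * x)) (is_derive_id (0 : R) (1 : R)).
  have := is_deriveD dZ (is_derive_cst (a 0 j * expR (e j * x)) (0 : R) (1 : R)).
  by rewrite addr0 /GRing.scale/= mulr1.
have := mx_derive_ysol eta_gt0 dz; rewrite scale0r add0r => /(_ i 0) dy.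
under eq_fun do rewrite Usol_ysol//.
exact: (@is_deriveZ _ _ _ _ (2 * e i) _ _ _ dy).
Qed.

Lemma derive_line n (f : 'rV[R]_n -> R) (p v : 'rV[R]_n) :
  'D_v f p = 'D_1 (fun t : R => f (t *: v + p)) 0.
Proof.
rewrite /derive; apply: (congr1 (fun g : R -> R => lim (g @ 0^'))).
apply/funext => h /=.
by rewrite scale0r add0r addr0 /GRing.scale/= mulr1.
Qed.

Lemma derive_Usol (c : 'rV[R]_N) i x :
  'D_c (fun b : 'rV[R]_N => Usol mu b i x) a =
  2 * e i * phisol e (\col_j (c 0 j / a 0 j)) (z x) i 0.
Proof. by rewrite derive_line; have [_ h] := Usol_dir c i x; exact h. Qed.

Lemma phisolD b b' w : phisol e (b + b') w = phisol e b w + phisol e b' w.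
Proof.
rewrite /phisol /rsol /Dmx !linearD/= !mulmxDl mulmxDr scalerDr.
by rewrite opprD addrACA.
Qed.

Lemma phisolZ t b w : phisol e (t *: b) w = t *: phisol e b w.
Proof.
rewrite /phisol /rsol /Dmx !linearZ/= -!scalemxAl -!scalemxAr.
by rewrite scalerBr !scalerA mulrC.
Qed.

(** Linearity in the direction is read off from the closed form: [phisol] is linear in [b], and the
    canonical directions give the vectors with the single entry 1 / a_k. *)
Lemma sum_dUsol (c : 'I_N -> R) i x :
  \sum_k c k * dUsol mu a k i x =
  2 * e i * phisol e (\col_j (c j / a 0 j)) (z x) i 0.
Proof.
have -> : \col_j (c j / a 0 j) = \sum_k c k *: \col_j ((delta_mx 0 k : 'rV[R]_N) 0 j / a 0 j).
  apply/colP => j; rewrite summxE (bigD1 j)//= big1 => [|k kj]; last first.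
    by rewrite !mxE eqxx /= eq_sym (negPf kj) mul0r mulr0.
  by rewrite addr0 !mxE !eqxx mul1r.
pose F b := 2 * e i * phisol e b (z x) i 0.
have FD b b' : F (b + b') = F b + F b' by rewrite /F phisolD mxE mulrDr.
have FZ t b : F (t *: b) = t * F b by rewrite /F phisolZ mxE mulrCA.
rewrite -/(F _) (big_morph F FD (_ : F 0 = 0)).
  by apply: eq_bigr => k _; rewrite FZ; congr (_ * _); exact: derive_Usol.
by rewrite -(scale0r 0) FZ mul0r.
Qed.

End SolitonDecay.

(** * Exponential decay, and independence of the variations *)

Section ExponentialDecay.
Context {R : realType} {N : nat} (e : 'I_N -> R) (a : 'cV[R]_N) (d : R).
Hypothesis d0 : 0 < d.
Hypothesis de : forall i, d <= e i.
Hypothesis e_inj : injective e.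
Hypothesis a0 : forall i, a i 0 != 0.
Implicit Types (v : R -> 'cV[R]_N) (x : R).

Let e0 i : 0 < e i. Proof. exact: lt_le_trans (de i). Qed.

(** One fixed rate d, at both ends and for the squared norm, makes this class stable under sums,
    bounded factors, diagonal matrices and A^-1. *)
Definition exp_decay v :=
  exists C, forall x, dotv (v x) (v x) <= C * expR (- d * `|x|).

Lemma exp_decayD v w : exp_decay v -> exp_decay w ->
  exp_decay (fun x => v x + w x).
Proof.
move=> [C vC] [D wD]; exists (2 * C + 2 * D) => x.
have := vC x; have := wD x; have : 0 <= dotv (v x - w x) (v x - w x).
  exact: dotvv_ge0.
rewrite dotvBr ![dotv (_ - _) _]dotvC !dotvBr dotvDr ![dotv (_ + _) _]dotvC.
by rewrite !dotvDr [dotv (w x) (v x)]dotvC; nra.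
Qed.

Lemma exp_decayZ (f : R -> R) v (M : R) : (forall x, `|f x| <= M) -> exp_decay v ->
  exp_decay (fun x => f x *: v x).
Proof.
move=> fM [C vC]; exists (M ^+ 2 * C) => x.
have f2 : f x ^+ 2 <= M ^+ 2.
  rewrite -(real_normK (num_real (f x))) lerXn2r ?nnegrE//.
  exact: le_trans (fM x).
rewrite dotvZr dotvC dotvZr [leLHS]mulrA -expr2 -mulrA.
by apply: ler_pM => //; rewrite ?sqr_ge0 ?dotvv_ge0.
Qed.

Lemma exp_decayZl c v : exp_decay v -> exp_decay (fun x => c *: v x).
Proof. by apply: exp_decayZ => x; exact: lexx. Qed.

Lemma exp_decayB v w : exp_decay v -> exp_decay w ->
  exp_decay (fun x => v x - w x).
Proof.
move=> dv /(exp_decayZl (-1)); under eq_fun do rewrite scaleN1r.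
exact: exp_decayD.
Qed.

Lemma exp_decay_Dmx b v : exp_decay v -> exp_decay (fun x => Dmx b *m v x).
Proof.
move=> [C vC]; exists (dotv b b * C) => x.
rewrite -mulrA (le_trans _ (ler_wpM2l (dotvv_ge0 b) (vC x)))// mulr_sumr.
apply: ler_sum => i _; rewrite DmxE mulrACA -!expr2.
by rewrite ler_wpM2r ?sqr_ge0// dotvv_sqr_le.
Qed.

Lemma exp_decay_invAmx (z v : R -> 'cV[R]_N) : exp_decay v ->
  exp_decay (fun x => invmx (Amx e (z x)) *m v x).
Proof.
move=> [C vC]; exists ((4 * d ^+ 2)^-1 * C) => x.
rewrite -mulrA (le_trans (invAmx_bound e0 _ _ d0 de))// ler_wpM2l//.
by rewrite invr_ge0 mulr_ge0 ?exprn_ge0 ?ltW.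
Qed.

Lemma exp_decay_bounded v : exp_decay v ->
  exists M, forall x, dotv (v x) (v x) <= M.
Proof.
move=> [C vC]; exists C => x; have C0 : 0 <= C.
  have := le_trans (dotvv_ge0 _) (vC 0).
  by rewrite normr0 mulr0 expR0 mulr1.
by rewrite (le_trans (vC x))// ler_piMr// -expR0 ler_expR mulNr oppr_le0 mulr_ge0// ltW.
Qed.

Lemma exp_decay_dotv v w : exp_decay v -> exp_decay w ->
  exists M, forall x, `|dotv (v x) (w x)| <= M.
Proof.
move=> /exp_decay_bounded[C vC] /exp_decay_bounded[D wD].
exists (C + D) => x; have := vC x; have := wD x.
have : 0 <= dotv (v x - w x) (v x - w x) by exact: dotvv_ge0.
have : 0 <= dotv (v x + w x) (v x + w x) by exact: dotvv_ge0.
rewrite dotvBr dotvDr ![dotv (_ - _) _]dotvC !dotvBr ![dotv (_ + _) _]dotvC.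
by rewrite !dotvDr [dotv (w x) (v x)]dotvC ler_norml => *; apply/andP; split; nra.
Qed.

Definition zexp x : 'cV[R]_N := \col_j (a j 0 * expR (e j * x)).

(** With such a c, the vector u = (c_j / z_j) satisfies K u = z, since the z_j cancel in each row of
    K. *)
Lemma cauchy_solve : exists c : 'cV[R]_N,
  forall i, \sum_j c j 0 / (e i + e j) = 1.
Proof.
pose C : 'M[R]_N := \matrix_(i, j) (e i + e j)^-1.
have Cu : C \in unitmx.
  rewrite -row_free_unit; apply/inj_row_free => v vC; apply/rowP => i.
  rewrite mxE; apply: (cauchy_form_eq0 e0 e_inj (v := v 0)).
  rewrite /cauchy_form exchange_big/= big1// => j _.
  have /rowP/(_ j) := vC; rewrite !mxE => vCj.
  transitivity (v 0 j * \sum_k v 0 k * C k j); last by rewrite vCj mulr0.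
  by rewrite mulr_sumr; apply: eq_bigr => k _; rewrite mxE mulrA [v 0 j * _]mulrC.
exists (invmx C *m const_mx 1) => i.
have /colP/(_ i) := mulKVmx Cu (const_mx 1 : 'cV[R]_N); rewrite mxE [RHS]mxE => cE.
by rewrite -[RHS]cE; apply: eq_bigr => j _; rewrite [C _ _]mxE mulrC.
Qed.

Lemma exp_le_decay k x : d <= k ->
  expR (- k * `|x|) ^+ 2 <= expR (- d * `|x|).
Proof.
move=> dk; rewrite expr2 -expRD ler_expR !mulNr -opprD lerN2.
rewrite -mulrDl ler_wpM2r// (le_trans dk)// lerDl.
by rewrite ltW// (lt_le_trans d0).
Qed.

(* As x -> -oo, z decays and the inverse of Amx is bounded. As x -> +oo, z is
   K u with u = O(1/z), so that y = u - 2 A^-1 (Lam u). *)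
Lemma exp_decay_ysol : exp_decay (fun x => ysol e (zexp x)).
Proof.
have [c cE] := cauchy_solve.
pose u x : 'cV[R]_N := \col_j (c j 0 / zexp x j 0).
(* Gluing the two regimes gives a single function decaying on the whole line; continuity at 0 plays
   no part in the class [exp_decay]. *)
pose v x := if x <= 0 then zexp x else u x.
have zN0 x j : zexp x j 0 != 0 by rewrite mxE mulf_neq0// gt_eqF ?expR_gt0.
have [C dv] : exp_decay v.
  exists (dotv a a + \sum_j (c j 0 / a j 0) ^+ 2) => x.
  rewrite /v; case: (leP x 0) => x0.
    rewrite mulrDl ler_wpDr//.
      by rewrite mulr_ge0 ?expR_ge0// sumr_ge0// => j _; rewrite sqr_ge0.
    rewrite mulr_suml; apply: ler_sum => j _; rewrite mxE -!expr2 exprMn.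
    rewrite ler_wpM2l ?sqr_ge0//.
    have := exp_le_decay x (de j); rewrite (ler0_norm x0).
    by rewrite !mulrN !mulNr !opprK.
  rewrite mulrDl ler_wpDl//.
    by rewrite mulr_ge0 ?expR_ge0// dotvv_ge0.
  rewrite mulr_suml; apply: ler_sum => j _; rewrite mxE -!expr2 mxE.
  rewrite invfM mulrA exprMn ler_wpM2l ?sqr_ge0// -expRN -mulNr.
  by have := exp_le_decay x (de j); rewrite (gtr0_norm x0).
have dv' : exp_decay v by exists C.
have dinv := exp_decay_invAmx zexp (exp_decay_Dmx (\col_i e i) dv').
(* [d1] bounds A^-1 v, which is y for x <= 0; [d2] bounds v - 2 A^-1 Lam v, which is y for x > 0. *)
have [C1 d1] := exp_decay_invAmx zexp dv'.
have [C2 d2] := exp_decayB dv' (exp_decayZl 2 dinv).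
exists (Num.max C1 C2) => x; case: (leP x 0) => x0.
  have := d1 x; rewrite /v x0 => /le_trans; apply.
  by rewrite ler_wpM2r ?expR_ge0// le_max lexx.
have Ku : Kmx e (zexp x) *m u x = zexp x.
  apply/colP => i; rewrite KmxE -[RHS]mulr1 -(cE i) mulr_sumr.
  apply: eq_bigr => j _; rewrite [u x j 0]mxE; field.
  by rewrite zN0 gt_eqF ?addr_gt0.
have := d2 x; rewrite /v (lt_geF x0) -(ysol_Kmx e0 Ku) => /le_trans; apply.
by rewrite ler_wpM2r ?expR_ge0// le_max lexx orbT.
Qed.

Lemma exp_decay_rsol b : exp_decay (fun x => rsol e b (zexp x)).
Proof.
apply: exp_decayZl; apply: exp_decay_invAmx; do 2 apply: exp_decay_Dmx.
exact: exp_decay_ysol.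
Qed.

Lemma exp_decay_ysol1 : exp_decay (fun x => ysol1 e (zexp x)).
Proof.
apply: exp_decayB; first exact: exp_decay_rsol.
exact: exp_decay_Dmx exp_decay_ysol.
Qed.

Lemma exp_decay_phisol b : exp_decay (fun x => phisol e b (zexp x)).
Proof.
by apply: exp_decayB; [exact: exp_decay_rsol | exact: exp_decay_Dmx exp_decay_ysol].
Qed.

Lemma exp_decay_phisol1 b : exp_decay (fun x => phisol1 e b (zexp x)).
Proof.
apply: exp_decayB; last exact: exp_decay_Dmx exp_decay_ysol1.
apply: exp_decayB.
  apply: exp_decayZl; apply: exp_decay_invAmx; do 2 apply: exp_decay_Dmx.
  exact: exp_decay_ysol1.
have [M dM] := exp_decay_dotv exp_decay_ysol
  (exp_decay_Dmx b (exp_decay_Dmx (\col_i e i) exp_decay_ysol)).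
apply: (@exp_decayZ _ _ (4 * M)); last exact: exp_decay_ysol.
by move=> x; rewrite dotv_z_rsol// normrM ger0_norm// ler_pM2l.
Qed.

Lemma phisol_inj0 b : (forall x, phisol e b (zexp x) = 0) -> b = 0.
Proof.
move=> phi0; have [C dy] := exp_decay_ysol.
have zN0 x j : zexp x j 0 != 0 by rewrite mxE mulf_neq0// gt_eqF ?expR_gt0.
apply/colP => j; rewrite [RHS]mxE.
(* [phisol_eq0] divided by z_j expresses b_j by terms decaying at -oo. *)
pose S := \sum_k `|b j 0 + b k 0| / (e j + e k) * (dotv a a + C).
have bS t : 0 <= t -> `|b j 0| <= S * expR (- d * t).
  move=> t0; have /colP/(_ j) := phisol_eq0 e0 (phi0 (- t)).
  rewrite coordE !DmxE !KmxE mulr_sumr -big_split/= => /eqP.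
  have -> : \sum_k (b j 0 * (zexp (- t) j 0 * zexp (- t) k 0 / (e j + e k)
      * ysol e (zexp (- t)) k 0) + zexp (- t) j 0 * zexp (- t) k 0 / (e j + e k)
      * (Dmx b *m ysol e (zexp (- t))) k 0) =
    (\sum_k (b j 0 + b k 0) / (e j + e k) *
      (zexp (- t) k 0 * ysol e (zexp (- t)) k 0)) * zexp (- t) j 0.
    by rewrite mulr_suml; apply: eq_bigr => k _; rewrite DmxE; ring.
  rewrite -subr_eq0 -mulrBl mulf_eq0 (negPf (zN0 _ _)) orbF subr_eq0 => /eqP ->.
  rewrite (le_trans (ler_norm_sum _ _ _))// mulr_suml ler_sum// => k _.
  rewrite normrM normrM normfV (gtr0_norm (addr_gt0 (e0 _) (e0 _))) -[leRHS]mulrA.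
  apply: ler_wpM2l; first by rewrite divr_ge0 ?normr_ge0 ?addr_ge0// ltW.
  have := dy (- t); rewrite normrN (ger0_norm t0) => dyt.
  have yk := le_trans (dotvv_sqr_le (ysol e (zexp (- t))) k) dyt.
  have zk : zexp (- t) k 0 ^+ 2 <= dotv a a * expR (- d * t).
    rewrite mxE exprMn mulrN -mulNr.
    have := exp_le_decay t (de k); rewrite (ger0_norm t0) => h.
    by rewrite ler_pM ?sqr_ge0// dotvv_sqr_le.
  move: yk zk; move: (ysol _ _ k 0) (zexp _ k 0) => p q yk zk.
  rewrite mulrDl ler_norml; by apply/andP; split; nra.
apply/eqP; rewrite -normr_eq0; apply/negP => /negP bN0.
have b0 : 0 < `|b j 0| by rewrite lt_neqAle eq_sym bN0 normr_ge0.
have S0 : 0 <= S by have := bS 0 (lexx _); rewrite mulr0 expR0 mulr1; lra.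
(* At this time d t = S / |b_j|, so |b_j| exp(d t) >= |b_j| + S > S, against [bS]. *)
have t0 : 0 <= S / `|b j 0| / d by rewrite !divr_ge0// ltW.
have := bS _ t0; rewrite mulNr mulrCA divff ?gt_eqF// mulr1 expRN.
rewrite ler_pdivlMr ?expR_gt0// leNgt => /negP; apply.
have := expR_ge1Dx (S / `|b j 0|); rewrite -(ler_pM2l b0) mulrDr mulr1.
by rewrite mulrCA divff ?gt_eqF// mulr1; apply: lt_le_trans; rewrite ltrDr.
Qed.

End ExponentialDecay.

(** * Smooth functions and a smooth step *)

Section SmoothFunctions.
Context {R : realType}.
Implicit Types (f g : R -> R) (x : R).

Lemma is_derive1_eq f x (df df' : R) :
  is_derive x (1 : R) f df -> df = df' -> is_derive x (1 : R) f df'.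
Proof. by move=> ? <-. Qed.

Definition smooth f := forall (n : nat) x, derivable (derive1n n f) x 1.

Lemma smooth_derivable f x : smooth f -> derivable f x 1.
Proof. by move=> /(_ 0%N x); rewrite derive1n0. Qed.

Lemma smooth_derive1 f : smooth f -> smooth (derive1 f).
Proof. by move=> sf n x; rewrite -derive1Sn; exact: sf. Qed.

Lemma smooth_continuous f : smooth f -> continuous f.
Proof.
by move=> sf x; apply/differentiable_continuous/derivable1_diffP/smooth_derivable.
Qed.

(* Smoothness by coinduction. *)
Lemma smooth_class (P : (R -> R) -> Prop) :
  (forall f, P f ->
     exists2 f', P f' & forall x, is_derive x (1 : R) f (f' x)) ->
  forall f, P f -> smooth f.
Proof.
move=> PP f Pf n; elim: n f Pf => [|n IHn] f /PP[f' Pf' df] x.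
  by rewrite derive1n0; have [] := df x.
rewrite derive1Sn (_ : (derive1 f) = f'); first exact: IHn.
by apply/funext => t; rewrite derive1E; have [_ ->] := df t.
Qed.

Lemma smooth_is_derive f x : smooth f -> is_derive x (1 : R) f ((derive1 f) x).
Proof.
by move=> sf; rewrite derive1E; apply/derivableP/smooth_derivable.
Qed.

Lemma smoothB f g : smooth f -> smooth g -> smooth (fun x => f x - g x).
Proof.
pose P h := exists f g, [/\ smooth f, smooth g & h = fun x => f x - g x].
move=> sf sg; apply: (@smooth_class P); last by exists f, g.
move=> _ [u [v [su sv ->]]]; exists (fun x => (derive1 u) x - (derive1 v) x).
  exists (derive1 u), (derive1 v); split; [exact: smooth_derive1..|].
  by [].
by move=> x; apply: is_deriveB; exact: smooth_is_derive.
Qed.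

(** Products of two smooth functions are not stable under differentiation, but their finite sums
    are, by the Leibniz rule; this is the class fed to [smooth_class]. *)
Inductive prod_sum : (R -> R) -> Prop :=
| prod_sumM f g of smooth f & smooth g : prod_sum (fun x => f x * g x)
| prod_sumD f g of prod_sum f & prod_sum g : prod_sum (fun x => f x + g x).

Lemma smooth_prod_sum f : prod_sum f -> smooth f.
Proof.
move: f; apply: smooth_class => f; elim=> [u v su sv|u v _ [u' Pu du] _ [v' Pv dv]].
  exists (fun x => (derive1 u x * v x) + (u x * derive1 v x)).
    exact: prod_sumD (prod_sumM (smooth_derive1 su) sv)
      (prod_sumM su (smooth_derive1 sv)).
  move=> x; have du := smooth_is_derive x su; have dv := smooth_is_derive x sv.
  by apply: is_derive_eq; rewrite /GRing.scale/= addrC [v x * _]mulrC.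
exists (fun x => u' x + v' x); first exact: prod_sumD.
by move=> x; exact: is_deriveD.
Qed.

Lemma smoothM f g : smooth f -> smooth g -> smooth (fun x => f x * g x).
Proof. by move=> sf sg; apply/smooth_prod_sum/prod_sumM. Qed.

Lemma smoothZ c f : smooth f -> smooth (fun x => c * f x).
Proof.
pose P h := exists2 f, smooth f & h = fun x => c * f x.
move=> sf; apply: (@smooth_class P); last by exists f.
move=> _ [u su ->]; exists (fun x => c * derive1 u x).
  by exists (derive1 u); first exact: smooth_derive1.
by move=> x; have du := smooth_is_derive x su; exact: (@is_deriveZ _ _ _ u).
Qed.

Lemma smoothD f g : smooth f -> smooth g -> smooth (fun x => f x + g x).
Proof.
move=> sf /(@smoothZ (-1) _)/(smoothB sf).
by under eq_fun do rewrite mulN1r opprK.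
Qed.

Lemma smooth_affine f (k c : R) : smooth f -> smooth (fun x => f (k * x + c)).
Proof.
(* The factor [m] collects the powers of [k] released by the chain rule. *)
pose P h := exists2 s, smooth s & exists m, h = fun x => m * s (k * x + c).
move=> sf; apply: (@smooth_class P); last first.
  by exists f => //; exists 1; apply/funext => x; rewrite mul1r.
move=> _ [u su [m ->]]; exists (fun x => (m * k) * derive1 u (k * x + c)).
  by exists (derive1 u); [exact: smooth_derive1|exists (m * k)].
move=> x; have du := smooth_is_derive (k * x + c) su.
have dk : is_derive x (1 : R) (fun t => k * t + c) k.
  rewrite (_ : (fun t => k * t + c) = k \*: id + cst c); last exact/funext.
  have dZ := is_deriveZ k (is_derive_id x (1 : R)).
  have := is_deriveD dZ (is_derive_cst c x (1 : R)).
  by rewrite addr0 /GRing.scale/= mulr1.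
have duk := @is_derive1_comp _ u (fun t => k * t + c) x _ _ du dk.
apply: (is_derive1_eq (is_deriveZ m duk)).
by rewrite /GRing.scale/=; ring.
Qed.

Lemma smoothV f g : smooth f -> smooth g -> (forall x, g x != 0) ->
  smooth (fun x => f x / g x).
Proof.
move=> sf sg g0.
(* Stable under differentiation: (u / g^(k+1))' = (u' g - (k + 1) u g') / g^(k+2). *)
pose P h := exists2 u, smooth u & exists k, h = fun x => u x * (g x)^-1 ^+ k.+1.
apply: (@smooth_class P); last by exists f => //; exists 0%N.
move=> _ [u su [k ->]].
exists (fun x => (derive1 u x * g x - k.+1%:R * (u x * derive1 g x)) * (g x)^-1 ^+ k.+2).
  exists (fun x => derive1 u x * g x - k.+1%:R * (u x * derive1 g x)); last by exists k.+1.
  exact: smoothB (smoothM (smooth_derive1 su) sg)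
    (smoothZ (smoothM su (smooth_derive1 sg))).
move=> x; have du := smooth_is_derive x su; have dg := smooth_is_derive x sg.
have dV := is_deriveX k.+1 (is_deriveV (g0 x) dg).
rewrite (_ : (fun t => _) = u * (fun t => (g t)^-1) ^+ k.+1); last first.
  by apply/funext => t; rewrite [RHS]/(u t * _) exprfctE.
apply: (is_derive1_eq (is_deriveM du dV)).
rewrite ?exprfctE /GRing.scale/= ![_ ^+ k.+2]exprS ![_ ^+ k.+1]exprS.
have := g0 x; move: (g x) (derive1 g x) (derive1 u x) (u x) => p q r t p0.
rewrite -exprVn; move: (p^-1 ^+ k) => w.
by field.
Qed.

(** The classical flat function exp(-1/x), with a polynomial in 1/x in front so that all its
    derivatives belong to the same family. *)
Definition flat_exp (p : {poly R}) x : R :=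
  if 0 < x then p.[x^-1] * expR (- x^-1) else 0.

(** For p X + c, half of the rate absorbs p by induction and the other half absorbs the factor s,
    through 1 + k s / 2 <= exp(k s / 2). *)
Lemma poly_le_exp (p : {poly R}) (k : R) : 0 < k ->
  exists2 C, 0 <= C & forall s, 0 <= s -> `|p.[s]| <= C * expR (k * s).
Proof.
elim/poly_ind: p k => [|p c IHp] k k0.
  by exists 0 => // s _; rewrite horner0 normr0 mul0r.
have [|C C0 pC] := IHp (k / 2); first by rewrite divr_gt0.
exists (C * (2 / k) + `|c|).
  by rewrite addr_ge0// mulr_ge0// divr_ge0// ltW.
move=> s s0; rewrite hornerMXaddC (le_trans (ler_normD _ _))// mulrDl lerD//; last first.
  by rewrite ler_peMr// -expR0 ler_expR mulr_ge0// ltW.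
rewrite normrM (ger0_norm s0).
have -> : C * (2 / k) * expR (k * s) =
    (C * expR (k / 2 * s)) * (2 / k * expR (k / 2 * s)).
  have -> : k * s = k / 2 * s + k / 2 * s by field.
  by rewrite expRD; ring.
apply: ler_pM => //; first exact: pC.
have : 2 / k * (1 + k / 2 * s) <= 2 / k * expR (k / 2 * s).
  by rewrite ler_pM2l ?expR_ge1Dx// divr_gt0.
apply: le_trans; rewrite mulrDr mulr1.
have -> : 2 / k * (k / 2 * s) = s by field; rewrite gt_eqF.
by rewrite lerDr divr_ge0// ltW.
Qed.

Lemma flat_exp_le (p : {poly R}) : exists C, forall x, `|flat_exp p x| <= C * x ^+ 2.
Proof.
(* Taken at s = 1/x, the extra X^2 is what leaves a factor x^2 in the bound. *)
have [C C0 pC] := @poly_le_exp (p * 'X^2) 1 ltr01.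
exists C => x; rewrite /flat_exp; case: ltP => x0; last first.
  by rewrite normr0 mulr_ge0 ?sqr_ge0.
have := pC x^-1; rewrite invr_ge0 ltW// => /(_ isT).
rewrite hornerM hornerXn mul1r normrM => h.
rewrite normrM (ger0_norm (expR_ge0 _)).
rewrite expRN ler_pdivrMr ?expR_gt0// mulrAC -ler_pdivrMr ?exprn_gt0//.
by move: h; rewrite exprVn (ger0_norm (_ : 0 <= x ^- 2))// invr_ge0 exprn_ge0// ltW.
Qed.

(** For x > 0, differentiating p(1/x) exp(-1/x) gives x^-2 (p - p')(1/x) exp(-1/x); at 0 the
    quadratic bound forces the derivative 0. *)
Lemma is_derive_flat_exp (p : {poly R}) x :
  is_derive x (1 : R) (flat_exp p) (flat_exp ('X^2 * (p - p^`())) x).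
Proof.
have [x0|x0|->] := ltgtP x 0.
- have near0 : \near x, cst 0 x = flat_exp p x.
    near=> t; rewrite /flat_exp ltNge ltW//.
    by near: t; exact: lt_nbhsl.
  apply: (@near_eq_is_derive R R R (cst 0) _ _ _ _ near0).
  by rewrite /flat_exp ltNge (ltW x0); exact: is_derive_cst.
- have near0 : \near x, (fun t => p.[t^-1] * expR (- t^-1)) x = flat_exp p x.
    near=> t; rewrite /flat_exp ifT//.
    by near: t; exact: lt_nbhsr.
  apply: (@near_eq_is_derive R R R _ _ _ _ _ near0); rewrite /flat_exp x0.
  have dV := is_deriveV (lt0r_neq0 x0) (is_derive_id x (1 : R)).
  have dp := @is_derive1_comp _ (horner p) _ _ _ _ (is_derive_poly p x^-1) dV.
  have dE := @is_derive1_comp _ expR (fun t => - t^-1) x _ _ (is_derive_expR _) (is_deriveN dV).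
  apply: (is_derive1_eq (is_deriveM dp dE)).
  rewrite /GRing.scale /= hornerM hornerXn hornerD hornerN exprVn.
  by ring.
- have fp0 q : flat_exp q 0 = 0 by rewrite /flat_exp ltxx.
  have [C pC] := flat_exp_le p.
  (* At t = 0 the quotient reads 0 / 0 = 0, which is the required derivative, so it serves as
     Caratheodory slope without a case distinction. *)
  rewrite fp0; apply/is_derive1_caratheodory; exists (fun t => flat_exp p t / t).
  split; last by rewrite fp0 mul0r.
    move=> t; rewrite fp0 !subr0; have [->|t0] := eqVneq t 0.
      by rewrite fp0 mulr0.
    by rewrite divfK.
  suff h : (fun t => flat_exp p t / t) x @[x --> (0 : R)] --> (0 : R).
    by rewrite /prop_for /continuous_at fp0 mul0r.
  apply/cvgr0Pnorm_le => eps eps0.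
  have C0 : 0 < `|C| + 1 by rewrite ltr_wpDl.
  have d0 : 0 < eps / (`|C| + 1) by rewrite divr_gt0.
  have := @nbhs0_lt _ R _ d0; apply: filterS => t td.
  have [->|t0] := eqVneq t 0; first by rewrite fp0 mul0r normr0 ltW.
  rewrite normrM normfV ler_pdivrMr ?normr_gt0//.
  rewrite (le_trans (pC t))// -(real_normK (num_real t)) expr2 mulrA ler_wpM2r//.
  move: td; rewrite ltr_pdivlMr// => /ltW; apply: le_trans; rewrite mulrC ler_wpM2l//.
  by rewrite (le_trans (ler_norm C))// lerDl.
Unshelve. all: by end_near. Qed.

(** The usual transition from 0 to 1 on [0, 1]; the denominator is positive because x and 1 - x are
    never both nonpositive. *)
Definition step x := flat_exp 1 x / (flat_exp 1 x + flat_exp 1 (1 - x)).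

Lemma smooth_flat_exp p : smooth (flat_exp p).
Proof.
pose P h := exists q, h = flat_exp q.
apply: (@smooth_class P); last by exists p.
move=> _ [q ->]; exists (flat_exp ('X^2 * (q - q^`()))).
  by exists ('X^2 * (q - q^`())).
exact: is_derive_flat_exp.
Qed.

Lemma flat_exp1_ge0 x : 0 <= flat_exp 1 x.
Proof. by rewrite /flat_exp; case: ifP => // _; rewrite hornerC mul1r expR_ge0. Qed.

Lemma flat_exp1_gt0 x : 0 < x -> 0 < flat_exp 1 x.
Proof. by move=> x0; rewrite /flat_exp x0 hornerC mul1r expR_gt0. Qed.

Lemma step_den_gt0 x : 0 < flat_exp 1 x + flat_exp 1 (1 - x).
Proof.
case: (ltP 0 x) => x0; first by rewrite ltr_pwDl ?flat_exp1_gt0 ?flat_exp1_ge0.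
by rewrite ltr_wpDl ?flat_exp1_ge0// flat_exp1_gt0//; lra.
Qed.

Lemma smooth_step : smooth step.
Proof.
apply: smoothV; first exact: smooth_flat_exp.
  apply: smoothD; first exact: smooth_flat_exp.
  rewrite (_ : (fun x => _) = fun x => flat_exp 1 (-1 * x + 1)); last first.
    by apply/funext => x; rewrite mulN1r addrC.
  exact: smooth_affine (@smooth_flat_exp 1).
by move=> x; rewrite gt_eqF ?step_den_gt0.
Qed.

Lemma step_le0 x : x <= 0 -> step x = 0.
Proof. by move=> x0; rewrite /step /flat_exp ltNge x0 mul0r. Qed.

Lemma step_ge1 x : 1 <= x -> step x = 1.
Proof.
move=> x1; rewrite /step [X in _ + X](_ : _ = 0) ?addr0 ?divff//.
  by rewrite gt_eqF// flat_exp1_gt0// (lt_le_trans ltr01).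
by rewrite /flat_exp ltNge subr_le0 x1.
Qed.

Lemma step_ge0 x : 0 <= step x.
Proof. by rewrite divr_ge0 ?flat_exp1_ge0// ltW ?step_den_gt0. Qed.

Lemma step_le1 x : step x <= 1.
Proof. by rewrite ler_pdivrMr ?step_den_gt0// mul1r lerDl flat_exp1_ge0. Qed.

Lemma derive1_step0 x : x < 0 \/ 1 < x -> derive1 step x = 0.
Proof.
move=> xout; rewrite derive1E.
have [c Ec] : exists c, \near x, cst c x = step x.
  case: xout => x0.
    exists 0; near=> t; rewrite step_le0// ltW//.
    by near: t; exact: lt_nbhsl.
  exists 1; near=> t; rewrite step_ge1// ltW//.
  by near: t; exact: lt_nbhsr.
by rewrite -(@near_eq_derive R R R (cst c) _ _ _ Ec) derive_cst.
Unshelve. all: by end_near. Qed.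

Lemma derive1_step_bounded : exists M, forall x, `|derive1 step x| <= M.
Proof.
have cs : {within `[0 : R, 1], continuous (fun x => `|derive1 step x|)}.
  apply: continuous_subspaceT => x; apply: cvg_norm.
  exact: smooth_continuous (smooth_derive1 smooth_step) x.
have [c _ cM] := EVT_max ler01 cs.
exists `|derive1 step c| => x.
case: (ltP x 0) => x0; first by rewrite derive1_step0 ?normr0//; left.
case: (ltP 1 x) => x1; first by rewrite (@derive1_step0 x) ?normr0//; right.
by apply: cM; rewrite in_itv/= x0 x1.
Qed.

End SmoothFunctions.

(** * Local integrability *)

Section LocalIntegrability.
Context {R : realType}.
Local Notation mu := (@lebesgue_measure R).
Implicit Types (f g h : R -> R) (a b r x : R).

Definition locint f := measurable_fun setT f /\
  forall a b, mu.-integrable `[a, b] (EFin \o f).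

Lemma locintB f g : locint f -> locint g -> locint (fun x => f x - g x).
Proof.
move=> [mf lf] [mg lg]; split; first exact: measurable_funB.
move=> a b; exact: (@integrableB _ _ _ mu `[a, b] (measurable_itv _) _ _
  (lf a b) (lg a b)).
Qed.

Lemma locintZ c f : locint f -> locint (fun x => c * f x).
Proof.
move=> [mf lf]; split; first exact: measurable_funM.
by move=> a b; exact: (@integrableZl _ _ _ mu `[a, b] (measurable_itv _) c _ (lf a b)).
Qed.

Lemma compact_sub_itv (K : set R) : compact K -> exists r, K `<=` `[- r, r].
Proof.
move=> /compact_bounded[M [_ Mb]]; exists (M + 1) => x Kx /=.
have Mlt : M < M + 1 by rewrite ltrDl.
by have /= := Mb _ Mlt x Kx; rewrite ler_norml in_itv.
Qed.

Lemma locint_locally_integrable f : locint f -> locally_integrable setT f.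
Proof.
move=> [mf lf]; split; [exact: mf|exact: openT|move=> K _ cK].
have [r Kr] := compact_sub_itv cK.
have mK : measurable K by exact: measurable_realfun.compact_measurable.
have /integrableP[_] : mu.-integrable K (EFin \o f).
  exact: integrableS (lf (- r) r).
by [].
Qed.

Lemma continuous_locint f : continuous f -> locint f.
Proof.
move=> cf; split; first exact: continuous_measurable_fun.
move=> a b; apply: continuous_compact_integrable; first exact: segment_compact.
exact: continuous_subspaceT.
Qed.

Lemma continuous_itv_bounded h a b : continuous h ->
  exists M, forall x, x \in `[a, b] -> `|h x| <= M.
Proof.
move=> ch; case: (leP a b) => [ab|ba]; last first.
  by exists 0 => x; rewrite in_itv/= => /andP[ax /(le_trans ax)]; rewrite leNgt ba.
have cn : {within `[a, b], continuous (fun x => `|h x|)}.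
  by apply: continuous_subspaceT => x; apply: cvg_norm; exact: ch.
by have [c _ cM] := EVT_max ab cn; exists `|h c|.
Qed.

Lemma locintM f h : locint f -> continuous h -> locint (fun x => f x * h x).
Proof.
have -> : (fun x => f x * h x) = (fun x => h x * f x).
  by apply/funext => x; rewrite mulrC.
move=> [mf lf] ch; have mh := continuous_measurable_fun ch; split.
  exact: measurable_funM.
move=> a b; have := @integrableMr _ _ _ mu `[a, b] (measurable_itv _) h (EFin \o f).
apply.
- exact: measurable_funTS.
- have [M hM] := continuous_itv_bounded a b ch.
  exists M; split; first exact: num_real.
  by move=> M' MM' x xab; rewrite /= (le_trans (hM x xab)) ?ltW.
- exact: lf.
Qed.

(** On a segment |f| is dominated by the integrable function 1 + f^2. *)
Lemma Lfun2_locint f : f \in Lfun mu 2%:E -> locint f.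
Proof.
move=> f2; have if2 := Lfun2_integrable_sqr f2.
have mf : measurable_fun setT f.
  by move: f2; rewrite inE => /andP[+ _]; rewrite inE.
split=> // a b.
pose F x := f x ^+ 2.
have i1 : mu.-integrable `[a, b] (cst 1%:E \+ (EFin \o F))%E.
  apply: integrableD => //.
    apply: (continuous_compact_integrable (f := cst 1)).
      exact: segment_compact.
    exact/continuous_subspaceT/cst_continuous.
  exact: integrableS if2.
apply: le_integrable i1 => //.
  by apply/measurable_EFinP; exact: measurable_funTS.
move=> x _ /=; rewrite lee_fin (ger0_norm (_ : 0 <= 1 + f x ^+ 2)); last first.
  by rewrite addr_ge0 ?sqr_ge0.
rewrite -(real_normK (num_real (f x))); move: `|f x| => t; nra.
Qed.

(** The passage between integrals over the line, in which distributions are stated, and integrals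
    over segments, on which calculus is done. *)
Lemma integrable_support f a b : mu.-integrable `[a, b] (EFin \o f) ->
  (forall x, x < a \/ b < x -> f x = 0) ->
  mu.-integrable setT (EFin \o f) /\
  \int[mu]_x f x = \int[mu]_(x in `[a, b]) f x.
Proof.
move=> fab f0; have fE : f = f \_ `[a, b].
  apply/funext => x; rewrite patchE; case: ifPn => // /negP.
  rewrite inE /= in_itv /= => /negP; rewrite negb_and -!ltNge => /orP xab.
  exact: f0.
split; last by rewrite [RHS]Rintegral_mkcond -fE.
by move: fab => /integrable_mkcond; rewrite restrict_EFin -fE; apply.
Qed.

End LocalIntegrability.

(** * Weak derivatives tested against plateaus *)

Section WeakDerivative.
Context {R : realType}.
Local Notation mu := (@lebesgue_measure R).
Implicit Types (f g psi : R -> R) (a b c x t : R) (n : nat).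

(** The step climbs from 0 to 1 on [x, x + 1/(n+1)]; its derivative [scaled_bump] is a one-sided
    approximate identity at x. *)
Definition scaled_step n x t := step (n.+1%:R * t + - (n.+1%:R * x)).

Definition scaled_bump n x t :=
  n.+1%:R * derive1 step (n.+1%:R * t + - (n.+1%:R * x)).

Lemma smooth_scaled_step n x : smooth (scaled_step n x).
Proof. exact: smooth_affine smooth_step. Qed.

Lemma is_derive_scaled_step n x t :
  is_derive t (1 : R) (scaled_step n x) (scaled_bump n x t).
Proof.
have ds := smooth_is_derive (n.+1%:R * t + - (n.+1%:R * x)) (@smooth_step R).
have dk : is_derive t (1 : R) (fun s => n.+1%:R * s + - (n.+1%:R * x)) n.+1%:R.
  rewrite (_ : (fun s => _) = (n.+1%:R : R) \*: id + cst (- (n.+1%:R * x))); last exact/funext.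
  have dZ := is_deriveZ n.+1%:R (is_derive_id t (1 : R)).
  have := is_deriveD dZ (is_derive_cst (- (n.+1%:R * x)) t (1 : R)).
  by rewrite addr0 /GRing.scale/= mulr1.
apply: (is_derive1_eq (@is_derive1_comp _ step (fun s => n.+1%:R * s + - (n.+1%:R * x)) t _ _ ds dk)).
by rewrite mulrC.
Qed.

Lemma scaled_step_lo n x t : t <= x -> scaled_step n x t = 0.
Proof. by move=> tx; rewrite /scaled_step -mulrBr step_le0// pmulr_rle0// subr_le0. Qed.

Lemma scaled_step_hi n x t : x + n.+1%:R^-1 <= t -> scaled_step n x t = 1.
Proof.
move=> tx; rewrite /scaled_step -mulrBr step_ge1// -(ler_pM2l (_ : 0 < n.+1%:R^-1)).
  by rewrite mulr1 mulKf// lerBrDl.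
by rewrite invr_gt0.
Qed.

Lemma scaled_bump_out n x t : t < x \/ x + n.+1%:R^-1 < t -> scaled_bump n x t = 0.
Proof.
move=> tx; rewrite /scaled_bump -mulrBr derive1_step0 ?mulr0//.
case: tx => tx; [left|right]; first by rewrite pmulr_rlt0// subr_lt0.
rewrite -(ltr_pM2l (_ : 0 < n.+1%:R^-1)) ?invr_gt0//.
by rewrite mulr1 mulKf// ltrBrDl.
Qed.

Lemma continuous_scaled_bump n x : continuous (scaled_bump n x).
Proof.
have -> : scaled_bump n x = derive1 (scaled_step n x).
  by apply/funext => t; rewrite derive1E; have [_ ->] := is_derive_scaled_step n x t.
exact/smooth_continuous/smooth_derive1/smooth_scaled_step.
Qed.

Lemma Rintegral_scaled_bump n x :
  \int[mu]_(t in `[x, x + n.+1%:R^-1]) scaled_bump n x t = 1.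
Proof.
have xn : x < x + n.+1%:R^-1 by rewrite ltrDl invr_gt0.
rewrite /Rintegral (@continuous_FTC2 _ _ (scaled_step n x) _ _ xn).
- by rewrite /= (scaled_step_lo _ (lexx _)) scaled_step_hi// subr0.
- apply: continuous_subspaceT; exact: continuous_scaled_bump.
- have cs := smooth_continuous (@smooth_scaled_step n x).
  split.
  + by move=> t _; apply: smooth_derivable; exact: smooth_scaled_step.
  + exact/cvg_at_right_filter/cs.
  + exact/cvg_at_left_filter/cs.
- by move=> t _; rewrite derive1E; have [_ ->] := is_derive_scaled_step n x t.
Qed.

Lemma scaled_bump_le : exists2 M, 0 <= M &
  forall n x t, `|scaled_bump n x t| <= n.+1%:R * M.
Proof.
have [M sM] := @derive1_step_bounded R; exists M.
  exact: le_trans (normr_ge0 _) (sM 0).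
by move=> n x t; rewrite normrM ger0_norm// ler_wpM2l.
Qed.

Lemma bump_integrable f n x : locint f ->
  mu.-integrable setT (EFin \o (fun t => f t * scaled_bump n x t)) /\
  \int[mu]_t (f t * scaled_bump n x t) =
  \int[mu]_(t in `[x, x + n.+1%:R^-1]) (f t * scaled_bump n x t).
Proof.
move=> lf; apply: integrable_support.
  have [_ +] := locintM lf (@continuous_scaled_bump n x); exact.
by move=> t xt; rewrite scaled_bump_out ?mulr0.
Qed.

Lemma bump_lebesgue_pt f x : locint f -> lebesgue_pt f x ->
  \int[mu]_t (f t * scaled_bump n x t) @[n --> \oo] --> f x.
Proof.
move=> lf lx; have [M M0 sM] := scaled_bump_le.
(* Twice the width of the bump, so that the open ball contains its closed support. The ball has
   measure 4 / (n + 1) and the bump is at most (n + 1) M, hence the constant 4 M in [bound]. *)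
pose r n : R := 2 / n.+1%:R.
have r0 n : 0 < r n by rewrite divr_gt0.
have lc : locint (fun t => f t - f x).
  exact: locintB lf (continuous_locint (@cst_continuous _ _ (f x))).
have mc D : measurable_fun D (fun t => `|(f t - f x)%:E|%E).
  apply: measurableT_comp => //; apply/measurable_EFinP.
  by apply: measurable_funTS; have [] := lc.
have ballI n : ball x (r n) `<=` `[x - r n, x + r n].
  by rewrite ball_itv => t /=; rewrite !in_itv/= => /andP[/ltW -> /ltW ->].
have davgE n : davg f x (r n) =
    ((n.+1%:R / 4)%:E * \int[mu]_(t in ball x (r n)) `|(f t - f x)%:E|)%E.
  rewrite /davg /iavg (lebesgue_measure_ball _ (ltW (r0 n))) inver.
  rewrite mulrn_eq0/= gt_eqF//; congr (_%:E * _)%E.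
  by rewrite /r -mulr_natr; field; rewrite ?pnatr_eq0.
have davg_fin n : davg f x (r n) \is a fin_num.
  rewrite davgE fin_numM// ge0_fin_numE ?integral_ge0//.
  have [_ lcI] := lc.
  suff /integrableP[] : mu.-integrable (ball x (r n)) (EFin \o (fun t => f t - f x)).
    by [].
  apply: (@integrableS _ _ _ mu `[x - r n, x + r n]) => //.
  exact: measurable_ball.
have bound n : `|\int[mu]_t (f t * scaled_bump n x t) - f x| <=
    4 * M * fine (davg f x (r n)).
  rewrite -lee_fin EFinM fineK//.
  have [lcI _] := bump_integrable n x lc.
  have lcI' : mu.-integrable `[x, x + n.+1%:R^-1]
    (EFin \o (fun t => (f t - f x) * scaled_bump n x t)) by exact: integrableS lcI.
  have -> : \int[mu]_t (f t * scaled_bump n x t) - f x =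
      \int[mu]_(t in `[x, x + n.+1%:R^-1]) ((f t - f x) * scaled_bump n x t).
    have [fI ->] := bump_integrable n x lf.
    have [_ bI] := locintZ (f x) (continuous_locint (@continuous_scaled_bump n x)).
    have [_ sI] := continuous_locint (@continuous_scaled_bump n x).
    have fxE : f x = \int[mu]_(t in `[x, x + n.+1%:R^-1]) (f x * scaled_bump n x t).
      by rewrite RintegralZl ?Rintegral_scaled_bump ?mulr1//; exact: sI.
    have fsI : mu.-integrable `[x, x + n.+1%:R^-1]
      (EFin \o (fun t => f t * scaled_bump n x t)) by exact: integrableS fI.
    have -> : (fun t => (f t - f x) * scaled_bump n x t) =
        (fun t => f t * scaled_bump n x t - f x * scaled_bump n x t).
      by apply/funext => t; rewrite mulrBl.
    by rewrite (RintegralB _ fsI (bI _ _)) -?fxE.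
  rewrite EFin_normr_Rintegral//.
  apply: le_trans; first apply: le_abse_integral => //.
    by have /integrableP[] := lcI'.
  apply: (@le_trans _ _ (\int[mu]_(t in ball x (r n))
      ((n.+1%:R * M)%:E * `|(f t - f x)%:E|))%E); last first.
    rewrite ge0_integralZl//; last 2 first.
    - exact: mc.
    - by rewrite lee_fin mulr_ge0.
    rewrite davgE muleA -EFinM.
    rewrite (_ : 4 * M * (n.+1%:R / 4) = n.+1%:R * M)//; first by field.
    exact: measurable_ball.
  pose F t := ((n.+1%:R * M)%:E * `|(f t - f x)%:E|)%E.
  apply: (@le_trans _ _ (integral mu `[x, x + n.+1%:R^-1] F)).
    apply: ge0_le_integral => //.
    - by apply: measurableT_comp => //; have /integrableP[] := lcI'.
    - by apply: measurable_funeM; exact: mc.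
    - by move=> t _; rewrite /= lee_fin normrM mulrC ler_wpM2r.
  apply: ge0_subset_integral => //.
  - exact: measurable_ball.
  - by apply: measurable_funeM; exact: mc.
  - by move=> t _; rewrite mule_ge0// lee_fin mulr_ge0.
  rewrite ball_itv => t /=; rewrite !in_itv/= => /andP[xt tx]; apply/andP; split.
    by rewrite (lt_le_trans _ xt)// ltrBlDr ltrDl.
  by rewrite (le_lt_trans tx)// ltrD2l /r -[ltLHS]mul1r ltr_pM2r ?invr_gt0// ltr1n.
have r_cvg : r n @[n --> \oo] --> (0 : R).
  rewrite -(mulr0 2); apply: cvgM; first exact: cvg_cst.
  exact: cvg_harmonic.
have dn : 4 * M * fine (davg f x (r n)) @[n --> \oo] --> (0 : R).
  rewrite -(mulr0 (4 * M)); apply: cvgM; first exact: cvg_cst.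
  have fl : fine (davg f x s) @[s --> (0 : R)^'+] --> (0 : R) by exact: fine_cvg.
  exact: ((cvg_at_rightP (fun s => fine (davg f x s)) 0 0).1 fl r (conj r0 r_cvg)).
apply/cvgrPdist_le => eps eps0; move/cvgrPdist_le : dn => /(_ _ eps0).
apply: filterS => n; rewrite sub0r normrN => h.
by rewrite distrC (le_trans (bound n))// (le_trans _ h)// ler_norm.
Qed.

Definition weak_deriv f g :=
  forall psi, test_function psi ->
  - (\int[mu]_x (f x * derive1 psi x)) = \int[mu]_x (g x * psi x).

Definition plateau a b n t := scaled_step n a t - scaled_step n b t.

Lemma smooth_plateau a b n : smooth (plateau a b n).
Proof. exact: smoothB (@smooth_scaled_step n a) (@smooth_scaled_step n b). Qed.

Lemma plateau_out a b n t : a < b -> t < a \/ b + n.+1%:R^-1 < t ->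
  plateau a b n t = 0.
Proof.
move=> ab [ta|bt]; rewrite /plateau.
  by rewrite !scaled_step_lo ?subrr// ltW// (lt_trans ta).
rewrite !scaled_step_hi ?subrr// ltW//.
by rewrite (le_lt_trans _ bt)// lerD2r ltW.
Qed.

Lemma test_plateau a b n : a < b -> test_function (plateau a b n).
Proof.
move=> ab; split; first exact: smooth_plateau.
apply: (subclosed_compact _ (@segment_compact _ a (b + n.+1%:R^-1))).
  exact: closed_closure.
have -> : `[a, b + n.+1%:R^-1]%classic = closure `[a, b + n.+1%:R^-1].
  apply/closure_id; apply: compact_closed; first exact: Rhausdorff.
  exact: segment_compact.
apply: closure_subset => t /= /eqP t0; rewrite in_itv/=; apply/andP; split.
  by rewrite leNgt; apply/negP => ta; apply: t0; rewrite plateau_out//; left.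
by rewrite leNgt; apply/negP => ta; apply: t0; rewrite plateau_out//; right.
Qed.

Lemma derive1_plateau a b n t :
  derive1 (plateau a b n) t = scaled_bump n a t - scaled_bump n b t.
Proof.
have da := is_derive_scaled_step n a t; have db := is_derive_scaled_step n b t.
by rewrite derive1E; have [_ ->] := is_deriveB da db.
Qed.

(** A step based at c vanishes at c itself and tends to 1 to the right of it, whence an interval
    open at a and closed at b. *)
Lemma plateau_cvg a b t : a < b ->
  plateau a b n t @[n --> \oo] --> (\1_`]a, b] t : R).
Proof.
move=> ab.
have step_cvg c : scaled_step n c t @[n --> \oo] --> (((c < t)%R : bool)%:R : R).
  case: (ltP c t) => ct; last first.
    under eq_cvg do rewrite scaled_step_lo//; exact: cvg_cst.
  apply: cvg_near_cst; have tc0 : 0 < t - c by rewrite subr_gt0.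
  have /cvgrPdist_lt/(_ _ tc0) := @cvg_harmonic R; apply: filterS => n.
  rewrite sub0r normrN /harmonic/= ger0_norm ?invr_ge0// => h.
  by rewrite scaled_step_hi// -lerBrDl ltW.
have -> : \1_`]a, b] t = ((a < t)%R : bool)%:R - ((b < t)%R : bool)%:R :> R.
  rewrite indicE mem_setE in_itv/= [X in _ && X]leNgt.
  case: (ltP a t) => /= [_|ta]; first by case: (b < t); rewrite ?subrr ?subr0.
  by rewrite (le_gtF (le_trans ta (ltW ab))) subr0.
exact: cvgB.
Qed.

Lemma plateau_norm_le1 a b n t : a < b -> `|plateau a b n t| <= 1.
Proof.
move=> ab; have := step_ge0 (n.+1%:R * t + - (n.+1%:R * a)).
have := step_le1 (n.+1%:R * t + - (n.+1%:R * a)).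
have := step_ge0 (n.+1%:R * t + - (n.+1%:R * b)).
have := step_le1 (n.+1%:R * t + - (n.+1%:R * b)).
by rewrite ler_norml /plateau /scaled_step => *; apply/andP; split; lra.
Qed.

Lemma plateau_Rintegral_cvg g a b : locint g -> a < b ->
  \int[mu]_x (g x * plateau a b n x) @[n --> \oo] -->
  \int[mu]_(x in `[a, b]) g x.
Proof.
move=> lg ab; have [mg ig] := lg.
pose f_ n x := (g x * plateau a b n x)%:E.
pose F x := (g x * \1_`]a, b] x)%:E.
(* All plateaus are supported in [a, b + 1], as 1/(n+1) <= 1; this is the dominating function. *)
pose G x := (`|g x| * \1_`[a, (b + 1)] x)%:E.
have mp n : measurable_fun setT (plateau a b n).
  exact: continuous_measurable_fun (smooth_continuous (@smooth_plateau a b n)).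
have iG : mu.-integrable setT G.
  have -> : G = (EFin \o (fun x => `|g x|)) \_ `[a, (b + 1)].
    apply/funext => x; rewrite /G patchE indicE; case: ifPn => // _.
      by rewrite mulr1.
    by rewrite mulr0.
  apply: (integrable_mkcond _ _).1 => //.
  by apply: integrable_norm; exact: ig.
have mF : measurable_fun setT F.
  by apply/measurable_EFinP; apply: measurable_funM => //; exact: measurable_indic.
have [|||iF _ lim] := @dominated_convergence _ _ _ mu setT measurableT f_ F G _ mF _ iG.
- move=> n; apply/measurable_EFinP.
  by apply: measurable_funM; [exact: mg|exact: mp].
- apply: aeW => x _; apply: cvg_EFin; first exact: nearW.
  by apply: cvgM; [exact: cvg_cst|exact: plateau_cvg].
- apply: aeW => x n _; rewrite /f_ /G /= lee_fin normrM indicE.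
  case: (boolP (_ \in _)) => [_|]; first by rewrite mulr1 ler_piMr// plateau_norm_le1.
  rewrite mem_setE in_itv/= negb_and -!ltNge => /orP xab.
  rewrite mulr0 plateau_out ?normr0 ?mulr0//; case: xab => xab; [by left|right].
  by rewrite (le_lt_trans _ xab)// lerD2l invf_le1// ler1n.
have -> : \int[mu]_(x in `[a, b]) g x = fine (\int[mu]_x F x).
  rewrite -[RHS]/(Rintegral _ _ _).
  rewrite -Rintegral_itv_obnd_cbnd; last first.
    by apply: integrableS (ig a b) => //; exact: subset_itv_oc_cc.
  rewrite Rintegral_mkcond; apply: eq_Rintegral => x _.
  by rewrite patchE indicE; case: ifPn; rewrite (mulr1, mulr0).
apply: fine_cvg; rewrite fineK//.
exact: integrable_fin_num.
Qed.

Lemma weak_deriv_lebesgue_pt f g a b : locint f -> locint g ->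
  weak_deriv f g -> lebesgue_pt f a -> lebesgue_pt f b -> a < b ->
  f b - f a = \int[mu]_(x in `[a, b]) g x.
Proof.
move=> lf lg fg fa fb ab.
have lim1 := bump_lebesgue_pt lf fa; have lim2 := bump_lebesgue_pt lf fb.
have lim3 := plateau_Rintegral_cvg lg ab.
have E n : \int[mu]_x (g x * plateau a b n x) =
   \int[mu]_x (f x * scaled_bump n b x) - \int[mu]_x (f x * scaled_bump n a x).
  have [ia _] := bump_integrable n a lf; have [ib _] := bump_integrable n b lf.
  rewrite -(fg _ (test_plateau n ab)) -opprB; congr (- _).
  rewrite -(RintegralB _ ia ib)//; apply: eq_Rintegral => t _.
  by rewrite derive1_plateau mulrBr.
have lim4 : \int[mu]_x (g x * plateau a b n x) @[n --> \oo] --> f b - f a.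
  by under eq_fun do rewrite E; exact: cvgB.
by rewrite -(cvg_lim _ lim3)// -(cvg_lim _ lim4).
Qed.

End WeakDerivative.

(** * Primitives of locally integrable functions *)

Section Primitive.
Context {R : realType}.
Local Notation mu := (@lebesgue_measure R).
Implicit Types (f g h : R -> R) (a b c x t : R).

Lemma ae_dense (P : R -> Prop) a b : a < b ->
  {ae mu, forall x : measurableTypeR R, P x} -> exists2 x, x \in `]a, b[ & P x.
Proof.
move=> ab [N [mN N0 PN]]; apply: contrapT => nP.
have abN : `]a, b[ `<=` N.
  by move=> x xab; apply: PN => /= Px; apply: nP; exists x.
have : (mu `]a, b[ <= mu N)%E by apply: le_measure; rewrite ?inE.
by rewrite N0 lebesgue_measure_itv/= lte_fin ab -EFinD lee_fin subr_le0 leNgt ab.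
Qed.

Lemma continuous_ae_eq f g : continuous f -> continuous g ->
  {ae mu, forall x : measurableTypeR R, f x = g x} -> f = g.
Proof.
move=> cf cg fg; apply/funext => x; apply/eqP; rewrite -subr_eq0; apply/negP => /negP fgx.
have e0 : 0 < `|f x - g x| by rewrite normr_gt0.
have ch : f t - g t @[t --> x] --> f x - g x by exact: cvgB (cf x) (cg x).
move/cvgrPdist_lt : ch => /(_ _ e0)/nbhs_ballP[d /= d0 dP].
have xd : x < x + d by rewrite ltrDl.
have [t tx ftg] := ae_dense xd fg.
suff /dP : ball x d t by rewrite /= ftg subrr subr0 ltxx.
rewrite /ball/= distrC; move: tx; rewrite in_itv/= => /andP[xt td].
by rewrite gtr0_norm ?subr_gt0// ltrBlDl.
Qed.

(** The oriented integral from 0 to x: for x nonzero one of the two segments is empty, and for x = 0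
    both are a point. *)
Definition prim g x := \int[mu]_(t in `[0, x]) g t - \int[mu]_(t in `[x, 0]) g t.

Lemma Rintegral_itv_le0 g a b : b <= a -> \int[mu]_(t in `[a, b]) g t = 0.
Proof.
rewrite le_eqVlt => /predU1P[->|ba]; first by rewrite set_itv1 Rintegral_set1.
by rewrite set_itv_ge ?Rintegral_set0// bnd_simp -ltNge.
Qed.

Lemma Rintegral_itvD g a b c : locint g -> a <= b -> b <= c ->
  \int[mu]_(t in `[a, c]) g t =
  \int[mu]_(t in `[a, b]) g t + \int[mu]_(t in `[b, c]) g t.
Proof.
move=> [_ lg] ab bc; have := @Rintegral_itvB R g (BLeft a) (BRight c) b (lg a c).
rewrite !bnd_simp => /(_ ab bc) E; rewrite -[X in _ + X]Rintegral_itv_obnd_cbnd.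
  by rewrite -E addrC subrK.
by apply: integrableS (lg b c) => //; exact: subset_itv_oc_cc.
Qed.

Lemma primB g a b : locint g -> a <= b ->
  prim g b - prim g a = \int[mu]_(t in `[a, b]) g t.
Proof.
move=> lg ab; rewrite /prim; case: (leP 0 a) => a0.
  rewrite (Rintegral_itv_le0 g a0) (Rintegral_itv_le0 g (le_trans a0 ab)).
  by rewrite !subr0 (Rintegral_itvD lg a0 ab) addrC addKr.
rewrite (Rintegral_itv_le0 g (ltW a0)) sub0r opprK; case: (leP 0 b) => b0.
  by rewrite (Rintegral_itv_le0 g b0) subr0 addrC -Rintegral_itvD// ltW.
rewrite (Rintegral_itv_le0 g (ltW b0)) (Rintegral_itvD lg ab (ltW b0)).
by rewrite sub0r addrC addrK.
Qed.

(** Near x, [prim g] differs by a constant from the integral based at x - 1, so that x becomes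
    interior to a segment on which the integral is known to be continuous. *)
Lemma prim_continuous g : locint g -> continuous (prim g).
Proof.
move=> lg x; have [_ ig] := lg.
have x11 : x - 1 <= x + 1 by lra.
have := @parameterized_integral_continuous R (x - 1) (x + 1) g x11 (ig _ _).
have x11' : x - 1 < x + 1 by lra.
move=> /continuous_within_itvP -/(_ x11')[cF _ _].
have xin : x \in `]x - 1, x + 1[ by rewrite in_itv/=; lra.
have ch : parameterized_integral mu (x - 1) t g + prim g (x - 1) @[t --> x] -->
    parameterized_integral mu (x - 1) x g + prim g (x - 1).
  by apply: cvgD; [exact: (cF x xin)|exact: cvg_cst].
have E t : x - 1 <= t -> parameterized_integral mu (x - 1) t g + prim g (x - 1) = prim g t.
  by move=> xt; rewrite /parameterized_integral -(primB lg xt) subrK.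
rewrite /continuous_at -(E x); last by lra.
apply: cvg_trans ch; apply: near_eq_cvg; near=> t; apply: E.
by apply: ltW; near: t; apply: lt_nbhsr; lra.
Unshelve. all: by end_near. Qed.

Lemma is_derive_prim g x : locint g -> {for x, continuous g} ->
  is_derive x (1 : R) (prim g) (g x).
Proof.
move=> lg cg; have [_ ig] := lg; have xx1 : x < x + 1 by rewrite ltrDl.
have x1x : x - 1 < x by rewrite gtrBl.
have [dF FE] := @continuous_FTC1_closed R g (x - 1) x (x + 1) xx1 (ig _ _) x1x cg.
pose F y := \int[mu]_(t in `[x - 1, y]) g t.
have dF' : is_derive x (1 : R) F (g x) by rewrite -FE derive1E; exact/derivableP.
have near_eq : \forall y \near x, (F + cst (prim g (x - 1))) y = prim g y.
  near=> y; have xy : x - 1 <= y by apply: ltW; near: y; exact: lt_nbhsr.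
  by rewrite -[LHS]/(F y + prim g (x - 1)) /F -(primB lg xy) subrK.
apply: (@near_eq_is_derive R R R _ _ _ _ _ near_eq).
by apply: (is_derive1_eq (is_deriveD dF' (is_derive_cst (prim g (x - 1)) x (1 : R)))); rewrite addr0.
Unshelve. all: by end_near. Qed.

(** Almost every x is a Lebesgue point and is compared with one fixed Lebesgue point p, which
    determines the constant. *)
Lemma weak_deriv_prim f g : locint f -> locint g -> weak_deriv f g ->
  exists c, {ae mu, forall x : measurableTypeR R, f x = c + prim g x}.
Proof.
move=> lf lg fg.
have lpt := lebesgue_differentiation (locint_locally_integrable lf).
have [p _ lp] := ae_dense ltr01 lpt.
exists (f p - prim g p).
apply: (@filterS _ _ (ae_filter_ringOfSetsType mu) _ _ _ lpt) => x lx.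
have [xp|px|->] := ltgtP x p; last by rewrite subrK.
  have := weak_deriv_lebesgue_pt lf lg fg lx lp xp.
  by rewrite -primB ?ltW// => E; lra.
have := weak_deriv_lebesgue_pt lf lg fg lp lx px.
by rewrite -primB ?ltW// => E; lra.
Qed.

End Primitive.

(** * From classical solutions to weak ones, and square integrability *)

Section ClassicalAndWeak.
Context {R : realType}.
Local Notation mu := (@lebesgue_measure R).
Implicit Types (f g h psi : R -> R) (a b c d x t : R).

Lemma test_function_support psi : test_function psi ->
  exists2 r, 0 < r & forall x, x < - r \/ r < x -> psi x = 0.
Proof.
move=> [_ cpsi]; have [r rP] := compact_sub_itv cpsi.
exists (`|r| + 1); first by rewrite ltr_wpDl.
move=> x xr; apply/eqP/negP => /negP x0.
have /rP : closure [set x | psi x != 0] x by exact: subset_closure.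
have rr : r <= `|r| by exact: ler_norm.
rewrite /= in_itv/= => /andP[]; case: xr => xr; move: (r) `|r| rr xr => ? ? *; lra.
Qed.

Lemma test_function_derive1 psi : test_function psi -> test_function (derive1 psi).
Proof.
move=> [spsi cpsi]; split; first exact: smooth_derive1.
apply: (subclosed_compact _ cpsi); first exact: closed_closure.
rewrite [X in _ `<=` X](_ : _ = closure (closure [set x | psi x != 0])); last first.
  by apply/closure_id; exact: closed_closure.
apply: closure_subset => x /= /eqP dx; apply: contrapT => nx; apply: dx.
have : nbhs x (~` closure [set x | psi x != 0]).
  by apply: open_nbhs_nbhs; split => //; apply: closed_openC; exact: closed_closure.
move=> nbx; have near0 : \forall y \near x, cst 0 y = psi y.
  apply: filterS nbx => y ny; apply/esym/eqP/negP => /negP y0; apply: ny.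
  exact: subset_closure.
by rewrite derive1E -(@near_eq_derive R R R (cst 0) psi x 1 near0) derive_cst.
Qed.

Lemma test_function_smooth psi : test_function psi -> smooth psi.
Proof. by case. Qed.

Lemma locint_test_integrable f psi : locint f -> test_function psi ->
  mu.-integrable setT (EFin \o (fun x => f x * psi x)).
Proof.
move=> lf tpsi; have [r r0 rP] := test_function_support tpsi.
have [_ +] := locintM lf (smooth_continuous (test_function_smooth tpsi)).
move=> /(_ (- r) r) lfpsi.
have [] := integrable_support lfpsi; last by [].
by move=> x /rP ->; rewrite mulr0.
Qed.

Lemma weak_deriv_classical f g : (forall x, is_derive x (1 : R) f (g x)) ->
  continuous g -> weak_deriv f g.
Proof.
move=> df cg psi tpsi; have [r r0 rP] := test_function_support tpsi.
have cf : continuous f.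
  by move=> x; apply/differentiable_continuous/derivable1_diffP; have [] := df x.
have spsi := test_function_smooth tpsi.
have cpsi := smooth_continuous spsi.
have cdpsi := smooth_continuous (smooth_derive1 spsi).
have [r' _ rP'] := test_function_support (test_function_derive1 tpsi).
(* The margin 1 makes [psi] vanish at the endpoints -s and s themselves, which removes the boundary
   terms of the integration by parts. *)
pose s := Num.max r r' + 1.
have [rs rs'] : r < s /\ r' < s.
  by split; rewrite /s ltr_pwDr// le_max lexx ?orbT.
have s0 : - s < s by lra.
have psi0 x : x <= - s \/ s <= x -> psi x = 0.
  by move=> xs; apply: rP; lra.
have fd0 x : x < - s \/ s < x -> f x * derive1 psi x = 0.
  by move=> xs; rewrite rP' ?mulr0//; lra.
have gd0 x : x < - s \/ s < x -> g x * psi x = 0.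
  by move=> xs; rewrite rP ?mulr0//; lra.
have lfd := locintM (continuous_locint cf) cdpsi.
have lgp := locintM (continuous_locint cg) cpsi.
have [_ ->] := integrable_support (lfd.2 (- s) s) fd0.
have [_ ->] := integrable_support (lgp.2 (- s) s) gd0.
rewrite (@Rintegration_by_parts R f psi g (derive1 psi) (- s) s s0).
- by rewrite !psi0 ?lexx; [rewrite !mulr0 subrr sub0r opprK|left|right].
- exact: continuous_subspaceT.
- split; [by move=> x _; have [] := df x| |].
  + exact/cvg_at_right_filter/cf.
  + exact/cvg_at_left_filter/cf.
- by move=> x _; rewrite derive1E; have [_ ->] := df x.
- exact: continuous_subspaceT.
- split; [by move=> x _; exact: smooth_derivable| |].
  + exact/cvg_at_right_filter/cpsi.
  + exact/cvg_at_left_filter/cpsi.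
- by [].
Qed.

Lemma integral_exp_decay_lty C d : 0 < d ->
  (\int[mu]_x (C * expR (- d * `|x|))%:E < +oo)%E.
Proof.
move=> d0; have cE : continuous (fun x => expR (- d * `|x|)).
  move=> x; apply: (@continuous_comp _ _ _ (fun x => - d * `|x|) expR).
    by apply: cvgM; [exact: cvg_cst|exact: norm_continuous].
  exact: continuous_expR.
have dF x : is_derive x (1 : R) (fun t => - (expR (- (d * t)) / d)) (expR (- (d * x))).
  have dl : is_derive x (1 : R) (fun t => - (d * t)) (- d).
    have := is_deriveN (is_deriveZ d (is_derive_id x (1 : R))).
    by rewrite /GRing.scale/= mulr1.
  have dE := @is_derive1_comp _ expR (fun t => - (d * t)) x _ _ (is_derive_expR _) dl.
  have dM := is_deriveN (is_deriveM dE (is_derive_cst d^-1 x (1 : R))).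
  apply: (is_derive1_eq dM).
  by rewrite /GRing.scale/= mulr0 add0r mulrN mulrN opprK mulrCA mulVf ?mulr1// gt_eqF.
have int1 : (\int[mu]_x (expR (- d * `|x|))%:E < +oo)%E.
  rewrite ge0_symfun_integralT//; last by move=> x /=; rewrite normrN.
  rewrite -set_itvcy (@ge0_continuous_FTC2y _ _ (fun x => - (expR (- (d * x)) / d)) _ 0).
  - by rewrite -EFinD -EFinM ltry.
  - by move=> x _; exact: expR_ge0.
  - exact: continuous_subspaceT.
  - rewrite -oppr0; apply: cvgN; rewrite -(mul0r d^-1); apply: cvgM; last exact: cvg_cst.
    apply: (@cvg_comp _ _ _ (fun x => d * x) (fun x => expR (- x)) _ (+oo%R)); last exact: cvgr_expR.
    exact: gt0_cvgMry.
  - by move=> x _; have [] := dF x.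
  - have cF : continuous (fun t => - (expR (- (d * t)) / d)).
      move=> x; apply/differentiable_continuous/derivable1_diffP.
      by have [] := dF x.
    exact: cvg_at_right_filter (cF 0).
  - move=> x; rewrite in_itv/= andbT => x0; rewrite derive1E; have [_ ->] := dF x.
    by rewrite gtr0_norm// mulNr.
have iE : mu.-integrable setT (EFin \o (fun x => expR (- d * `|x|))).
  apply/integrableP; split; first by apply/measurable_EFinP; exact: continuous_measurable_fun.
  by under eq_integral do rewrite /= ger0_norm ?expR_ge0//.
exact: integrable_lty (integrableZl measurableT C iE).
Qed.

Lemma exp_decay_Lfun2 f C d : 0 < d -> continuous f ->
  (forall x, f x ^+ 2 <= C * expR (- d * `|x|)) -> f \in Lfun mu 2%:E.
Proof.
move=> d0 cf fC; have mf := continuous_measurable_fun cf.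
rewrite inE; apply/andP; split; rewrite inE//=.
rewrite /finite_norm unlock; apply: poweR_lty.
apply: le_lt_trans (integral_exp_decay_lty C d0).
have cE : continuous (fun x => C * expR (- d * `|x|)).
  move=> x; apply: cvgM; first exact: cvg_cst.
  apply: (@continuous_comp _ _ _ (fun x => - d * `|x|) expR).
    by apply: cvgM; [exact: cvg_cst|exact: norm_continuous].
  exact: continuous_expR.
apply: ge0_le_integral => //.
- by move=> x _; exact: poweR_ge0.
- apply/measurable_EFinP.
  apply/(@measurableT_comp _ _ _ _ _ _ (fun x : R => x `^ 2)%R) => //.
  exact/measurableT_comp.
- by apply/measurable_EFinP; exact: continuous_measurable_fun.
- by move=> x _; rewrite /= lee_fin powR_mulrn// -normrX ger0_norm ?sqr_ge0.
Qed.

End ClassicalAndWeak.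

(** * Lagrangian subspaces *)

Section LagrangianSubspace.
Context {F : fieldType} {n : nat}.
Implicit Types (A B : 'M[F]_n) (u v b : 'rV[F]_n).

(* A vector symplectically orthogonal to the Lagrangian row space of (A, B)
   belongs to it. *)
Lemma lagrangian_complete A B u v :
  (forall b, b *m A = 0 -> b *m B = 0 -> b = 0) ->
  B *m A^T = A *m B^T -> v *m A^T = u *m B^T ->
  exists b, u = b *m A /\ v = b *m B.
Proof.
(* Y is X rotated by the symplectic matrix, so symplectic orthogonality to the rows of X is
   membership of the rotated vector in [kermx X^T]. Isotropy puts Y in that kernel, and both have
   rank 2 n - n = n. *)
move=> inj iso uv; pose X := row_mx A B; pose Y := row_mx B (- A).
have rX : \rank X = n.
  apply/eqP; rewrite -/(row_free X); apply/inj_row_free => b.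
  by rewrite mul_mx_row -row_mx0 => /eq_row_mx[]; exact: inj.
have rY : \rank Y = n.
  apply/eqP; rewrite -/(row_free Y); apply/inj_row_free => b.
  rewrite mul_mx_row -row_mx0 mulmxN => /eq_row_mx[bB /eqP].
  by rewrite oppr_eq0 => /eqP bA; exact: inj.
have YX : (Y <= kermx X^T)%MS.
  by apply/sub_kermxP; rewrite tr_row_mx mul_row_col mulNmx iso subrr.
have KY : (kermx X^T <= Y)%MS.
  rewrite -(geq_leqif (mxrank_leqif_sup YX)) mxrank_ker mxrank_tr rX rY.
  by rewrite addnK.
have /submx_trans/(_ KY)/submxP[b] : (row_mx v (- u) <= kermx X^T)%MS.
  by apply/sub_kermxP; rewrite tr_row_mx mul_row_col mulNmx uv subrr.
rewrite mul_mx_row mulmxN => /eq_row_mx[-> /oppr_inj ->].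
by exists b.
Qed.

End LagrangianSubspace.

(** * Symmetric second-order systems: Wronskian and uniqueness *)

Section SymmetricSystem.
Context {R : realType} {N : nat} (P : R -> 'M[R]_N).
Local Notation mu := (@lebesgue_measure R).
Implicit Types (u v : R -> 'cV[R]_N) (x : R).

(* The system u'' = P u, with v = u'. *)
Definition sol u v :=
  forall x, mx_derive u x (v x) /\ mx_derive v x (P x *m u x).

Lemma solB u v u' v' : sol u v -> sol u' v' ->
  sol (fun x => u x - u' x) (fun x => v x - v' x).
Proof.
move=> s s' x; have [du dv] := s x; have [du' dv'] := s' x; split.
  exact: mx_deriveB.
by rewrite mulmxBr; exact: mx_deriveB.
Qed.

Lemma sol_sum n (c : 'I_n -> R) (u v : 'I_n -> R -> 'cV[R]_N) :
  (forall k, sol (u k) (v k)) ->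
  sol (fun x => \sum_k c k *: u k x) (fun x => \sum_k c k *: v k x).
Proof.
move=> s x; split.
  by apply: mx_derive_sum => k; have [du _] := s k x; exact: mx_deriveZl.
rewrite mulmx_sumr; apply: mx_derive_sum => k; have [_ dv] := s k x.
by rewrite -scalemxAr; exact: mx_deriveZl.
Qed.

Lemma sol_continuous u v i : sol u v ->
  continuous (fun x => u x i 0) /\ continuous (fun x => v x i 0).
Proof.
move=> s; split=> x; apply/differentiable_continuous/derivable1_diffP;
  have [du dv] := s x.
- by have [] := du i 0.
- by have [] := dv i 0.
Qed.

Hypothesis P_sym : forall x, (P x)^T = P x.

Lemma wronskian_cst u v u' v' : sol u v -> sol u' v' -> forall x,
  dotv (v x) (u' x) - dotv (u x) (v' x) = dotv (v 0) (u' 0) - dotv (u 0) (v' 0).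
Proof.
move=> s s' x.
apply: (@is_derive_0_is_cst R (fun t => dotv (v t) (u' t) - dotv (u t) (v' t))) => t.
have [du dv] := s t; have [du' dv'] := s' t.
apply: (is_derive1_eq (is_deriveB (is_derive_dotv dv du') (is_derive_dotv du dv'))).
by rewrite dotv_mulmxr P_sym; ring.
Qed.

Hypothesis P_cont : forall i j, continuous (fun x => P x i j).

Lemma P_bounded r : exists2 m, 0 <= m &
  forall x i j, x \in `[- r, r] -> `|P x i j| <= m.
Proof.
pose M i j := sval (cid (continuous_itv_bounded (- r) r (@P_cont i j))).
have MP i j := svalP (cid (continuous_itv_bounded (- r) r (@P_cont i j))).
exists (\sum_i \sum_j `|M i j|); first by do 2 (apply: sumr_ge0 => ? _).
move=> x i j xr; rewrite (le_trans (MP i j x xr))//.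
rewrite (bigD1 i)//= (bigD1 j)//= -addrA (le_trans (ler_norm _))// lerDl.
by rewrite addr_ge0//; apply: sumr_ge0 => // ? _; apply: sumr_ge0.
Qed.

Lemma dotv_norm_le (p q : 'cV[R]_N) : `|2 * dotv p q| <= dotv p p + dotv q q.
Proof.
have E c : dotv (p + c *: q) (p + c *: q) =
    dotv p p + 2 * c * dotv p q + c ^+ 2 * dotv q q.
  rewrite dotvDr dotvZr [dotv (_ + _) p]dotvC [dotv (_ + _) q]dotvC.
  by rewrite !dotvDr !dotvZr [dotv q p]dotvC; ring.
have := dotvv_ge0 (p + 1 *: q); have := dotvv_ge0 (p + (- 1) *: q).
by rewrite !E ler_norml => *; apply/andP; split; lra.
Qed.

Definition energy u v x := dotv (u x) (u x) + dotv (v x) (v x).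

Lemma is_derive_energy u v x : sol u v -> is_derive x (1 : R) (energy u v)
  (2 * dotv (u x) (v x) + 2 * dotv (v x) (P x *m u x)).
Proof.
move=> s; have [du dv] := s x.
apply: (is_derive1_eq (is_deriveD (is_derive_dotv du du) (is_derive_dotv dv dv))).
by rewrite [dotv (v x) (u x)]dotvC [dotv (P x *m _) _]dotvC; ring.
Qed.

Lemma energy_deriv_le u v r : exists K, forall x, x \in `[- r, r] ->
  `|2 * dotv (u x) (v x) + 2 * dotv (v x) (P x *m u x)| <= K * energy u v x.
Proof.
(* The 1 pays for 2 u.v; each of the N^2 terms 2 v_i P_ij u_j is at most m (v_i^2 + u_j^2), and
   every square occurs N times in the sum. *)
have [m m0 Pm] := P_bounded r; exists (1 + m * N%:R) => x xr.
rewrite [leRHS]mulrDl mul1r; apply: le_trans (ler_normD _ _) _; apply: lerD.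
  exact: dotv_norm_le.
have -> : dotv (v x) (P x *m u x) = \sum_i \sum_j v x i 0 * P x i j * u x j 0.
  by apply: eq_bigr => i _; rewrite mxE mulr_sumr; apply: eq_bigr => j _; rewrite mulrA.
have -> : m * N%:R * energy u v x =
    \sum_(i < N) \sum_(j < N) m * (v x i 0 ^+ 2 + u x j 0 ^+ 2).
  rewrite -mulrA mulr_natl.
  under eq_bigr do rewrite -mulr_sumr big_split/= sumr_const card_ord.
  rewrite -mulr_sumr big_split/= sumr_const card_ord -sumrMnl /energy addrC mulrnDl.
  congr (_ * (_ + _)).
    by rewrite /dotv -sumrMnl; apply: eq_bigr => i _; rewrite expr2.
  by rewrite /dotv -!sumrMnl; apply: eq_bigr => i _; rewrite expr2.
rewrite mulr_sumr (le_trans (ler_norm_sum _ _ _))// ler_sum// => i _.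
rewrite mulr_sumr (le_trans (ler_norm_sum _ _ _))// ler_sum// => j _.
rewrite (_ : 2 * _ = P x i j * (2 * (v x i 0 * u x j 0))); last by ring.
rewrite normrM ler_pM// ?Pm// ler_norml.
move: (v x i 0) (u x j 0) => p q.
have h1 : 0 <= p ^+ 2 + q ^+ 2 - 2 * (p * q).
  by rewrite (_ : _ - _ = (p - q) ^+ 2) ?sqr_ge0//; ring.
have h2 : 0 <= p ^+ 2 + q ^+ 2 + 2 * (p * q).
  by rewrite (_ : _ + 2 * _ = (p + q) ^+ 2) ?sqr_ge0//; ring.
by apply/andP; split; lra.
Qed.

Lemma is_derive_energy_exp u v k x : sol u v ->
  is_derive x (1 : R) (fun t => energy u v t * expR (k * t))
  ((2 * dotv (u x) (v x) + 2 * dotv (v x) (P x *m u x) + k * energy u v x)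
    * expR (k * x)).
Proof.
move=> s; have dE := is_derive_energy x s.
have dk : is_derive x (1 : R) (fun t => k * t) k.
  by have := is_deriveZ k (is_derive_id x (1 : R)); rewrite /GRing.scale/= mulr1.
have dexp := @is_derive1_comp _ expR (fun t => k * t) x _ _ (is_derive_expR _) dk.
apply: (is_derive1_eq (is_deriveM dE dexp)).
by rewrite /GRing.scale/=; ring.
Qed.

(* Gronwall: the energy grows at most exponentially in both directions. *)
Lemma sol_eq0 u v : sol u v -> u 0 = 0 -> v 0 = 0 -> forall x, u x = 0.
Proof.
move=> s u0 v0 x; have E0 : energy u v 0 = 0.
  rewrite /energy u0 v0 /dotv !big1 ?addr0// => i _; by rewrite mxE mul0r.
suff Ex : energy u v x <= 0.
  apply/colP => i; rewrite mxE; apply/eqP; rewrite -sqrf_eq0 eq_le sqr_ge0 andbT.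
  apply: le_trans (dotvv_sqr_le (u x) i) _; apply: le_trans _ Ex.
  by rewrite lerDl dotvv_ge0.
pose r := `|x| + 1; have xr : `|x| < r by rewrite ltrDl.
have [K EK] := energy_deriv_le u v r.
(* With k = -K this is nonincreasing on [0, r], with k = K nondecreasing on [-r, 0]; as it vanishes
   at 0, the energy is nonpositive on both sides. *)
pose F k t := energy u v t * expR (k * t).
pose D t := 2 * dotv (u t) (v t) + 2 * dotv (v t) (P t *m u t).
have dF k t : is_derive t (1 : R) (F k) ((D t + k * energy u v t) * expR (k * t)).
  exact: is_derive_energy_exp.
have cF k a b : {within `[a, b], continuous (F k)}.
  apply: continuous_subspaceT => t.
  by apply/differentiable_continuous/derivable1_diffP; have [] := dF k t.
have EKt t : - r <= t -> t <= r -> - (K * energy u v t) <= D t <= K * energy u v t.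
  by move=> rt tr; rewrite -ler_norml; apply: EK; rewrite in_itv/= rt tr.
have r0 : 0 < r by rewrite (le_lt_trans _ xr).
move: xr; rewrite ltr_norml => /andP[rx xr].
have [x0|x0] := leP 0 x.
  have := @ler0_derive1_nincr R (F (- K)) 0 r _ _ (cF _ _ _) 0 x (lexx _) x0 (ltW xr).
  rewrite /F E0 mul0r pmulr_lle0 ?expR_gt0//; apply.
    by move=> t _; have [] := dF (- K) t.
  move=> t; rewrite in_itv/= => /andP[t0 tr]; rewrite derive1E.
  have [_ ->] := dF (- K) t; rewrite pmulr_lle0 ?expR_gt0//.
  have rt : - r <= t by lra.
  by have /andP[_ ?] := EKt t rt (ltW tr); lra.
have := @ger0_derive1_ndecr R (F K) (- r) 0 _ _ (cF _ _ _) x 0 (ltW rx) (ltW x0) (lexx _).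
rewrite /F E0 mul0r pmulr_lle0 ?expR_gt0//; apply.
  by move=> t _; have [] := dF K t.
move=> t; rewrite in_itv/= => /andP[t0 tr]; rewrite derive1E.
have [_ ->] := dF K t; rewrite pmulr_lge0 ?expR_gt0//.
have tr' : t <= r by lra.
by have /andP[? _] := EKt t (ltW t0) tr'; lra.
Qed.

End SymmetricSystem.

(** * The kernel of the linearized operator as an ODE solution space *)

Section Kernel.
Context {R : realType} {N : nat} (mu : 'I_N -> R) (U : 'I_N -> R -> R).
Local Notation leb := (@lebesgue_measure R).
Implicit Types (phi : 'I_N -> R -> R) (x : R).

(** The line has infinite measure; this is what makes an integrable constant Wronskian vanish. *)
Lemma integrable_ae_cst (w : R -> R) c : leb.-integrable setT (EFin \o w) ->
  {ae leb, forall x : measurableTypeR R, w x = c} -> c = 0.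
Proof.
move=> /integrableP[mw iw] wc; apply/eqP; apply: contraLR iw => c0.
rewrite -leNgt (@ae_eq_integral _ _ _ leb setT (cst `|c|%:E))//=.
- have lebT : leb setT = +oo%E by rewrite -set_itvNyy lebesgue_measure_itv.
  by rewrite integral_cst// [X in (_ * X)%E]lebT mulry gtr0_sg ?normr_gt0// mul1e lexx.
- apply/measurable_EFinP; apply: measurableT_comp; first by [].
  exact/measurable_EFinP.
- by apply: filterS wc => x /= -> _.
Qed.

(* Potential of the linearized equation phi'' = Pmx phi. *)
Definition Pmx x : 'M[R]_N := \matrix_(i, j)
  ((- mu i - 2 * \sum_k U k x ^+ 2) *+ (i == j) - 4 * (U i x * U j x)).

Lemma Pmx_sym x : (Pmx x)^T = Pmx x.
Proof.
apply/matrixP => i j; rewrite !mxE [U j x * _]mulrC eq_sym.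
by case: eqP => [->|].
Qed.

Lemma PmxE x (v : 'cV[R]_N) i : (Pmx x *m v) i 0 =
  - mu i * v i 0 - 2 * ((\sum_k U k x ^+ 2) * v i 0)
  - 4 * (U i x * \sum_j U j x * v j 0).
Proof.
rewrite mxE; under eq_bigr do rewrite mxE mulrBl.
move: (\sum_k U k x ^+ 2) => Q.
rewrite sumrB (bigD1 i)//= eqxx mulr1n big1 ?addr0 => [|j ji]; last first.
  by rewrite eq_sym (negPf ji) mulr0n mul0r.
rewrite mulrBl mulrA; congr (_ - _); rewrite mulrA mulr_sumr.
by apply: eq_bigr => j _; ring.
Qed.

Hypothesis U_cont : forall i, continuous (U i).

Lemma continuous_bigsum n (f : 'I_n -> R -> R) : (forall k, continuous (f k)) ->
  continuous (fun x => \sum_k f k x).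
Proof.
move=> cf; elim: (index_enum _) => [|k r IHr].
  by under eq_fun do rewrite big_nil; exact: cst_continuous.
under eq_fun do rewrite big_cons.
by move=> x; apply: cvgD; [exact: cf|exact: IHr].
Qed.

Lemma sum_U_cont : continuous (fun x => \sum_k U k x ^+ 2).
Proof.
apply: continuous_bigsum => k; under eq_fun do rewrite expr2.
move=> x; by apply: cvgM; exact: U_cont.
Qed.

Lemma Pmx_cont i j : continuous (fun x => Pmx x i j).
Proof.
have cUU : continuous (fun x => 4 * (U i x * U j x)).
  move=> x; apply: cvgM; first exact: cvg_cst.
  exact: cvgM (@U_cont i x) (@U_cont j x).
have cQ : continuous (fun x => - mu i - 2 * \sum_k U k x ^+ 2).
  move=> x; apply: cvgB; first exact: cvg_cst.
  by apply: cvgM; [exact: cvg_cst|exact: sum_U_cont].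
under eq_fun do rewrite mxE; case: eqP => _.
  by under eq_fun do rewrite mulr1n; move=> x; exact: cvgB (cQ x) (cUU x).
under eq_fun do rewrite mulr0n; move=> x.
by apply: cvgB; [exact: cvg_cst|exact: cUU].
Qed.

Lemma Pmx_mul_cont (u : R -> 'cV[R]_N) i : (forall j, continuous (fun x => u x j 0)) ->
  continuous (fun x => (Pmx x *m u x) i 0).
Proof.
move=> cu; under eq_fun do rewrite mxE; apply: continuous_bigsum => j x.
by apply: cvgM; [exact: Pmx_cont|exact: cu].
Qed.

Definition colf phi x : 'cV[R]_N := \col_i phi i x.

Lemma colfE phi x i : colf phi x i 0 = phi i x.
Proof. exact: mxE. Qed.

Lemma locintD f g : @locint R f -> locint g -> locint (fun x => f x + g x).
Proof.
move=> lf /(locintZ (-1)) lg; have := locintB lf lg.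
by under eq_fun do rewrite mulN1r opprK.
Qed.

Lemma locint_sum n (f : 'I_n -> R -> R) : (forall j, locint (f j)) ->
  locint (fun x => \sum_j f j x).
Proof.
move=> lf; elim: (index_enum _) => [|j r IHr].
  by under eq_fun do rewrite big_nil; exact: (continuous_locint (@cst_continuous _ _ 0)).
by under eq_fun do rewrite big_cons; exact: locintD.
Qed.

Lemma locint_Pmx phi i : (forall j, locint (phi j)) ->
  locint (fun x => (Pmx x *m colf phi x) i 0).
Proof.
move=> lphi; under eq_fun do rewrite mxE; apply: locint_sum => j.
under eq_fun do rewrite mulrC; apply: locintM; last exact: Pmx_cont.
by under eq_fun do rewrite mxE.
Qed.

(** The zeroth-order distributions merge into one integral because each integrand is integrable:
    [phi] is locally integrable, U continuous, and [psi] has compact support. *)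
Lemma linearizedE phi i psi : (forall j, locint (phi j)) -> test_function psi ->
  linearized mu U phi i psi =
  - (\int[leb]_x (phi i x * derive1 (derive1 psi) x)) +
    \int[leb]_x ((Pmx x *m colf phi x) i 0 * psi x).
Proof.
move=> lphi tpsi.
have lQ : locint (fun x => (\sum_k U k x ^+ 2) * phi i x).
  by under eq_fun do rewrite mulrC; apply: locintM => //; exact: sum_U_cont.
have lS : locint (fun x => U i x * \sum_j U j x * phi j x).
  under eq_fun do rewrite mulrC; apply: locintM => //; apply: locint_sum => j.
  by under eq_fun do rewrite mulrC; apply: locintM.
have i1 := locint_test_integrable (lphi i) tpsi.
have i2 := locint_test_integrable lQ tpsi.
have i3 := locint_test_integrable lS tpsi.
set A := \int[leb]_x (phi i x * derive1 (derive1 psi) x).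
rewrite -[LHS]/(- (- - A) - mu i * \int[leb]_x (phi i x * psi x)
  - 2 * \int[leb]_x ((\sum_j U j x ^+ 2) * phi i x * psi x)
  - 4 * \int[leb]_x (U i x * (\sum_j U j x * phi j x) * psi x)).
rewrite opprK -2!addrA; congr (_ + _).
have j1 := integrableZl measurableT (- mu i) i1.
have j2 := integrableZl measurableT 2 i2.
have j3 := integrableZl measurableT 4 i3.
rewrite -mulNr -(RintegralZl _ measurableT i1) -(RintegralZl _ measurableT i2).
rewrite -(RintegralZl _ measurableT i3) addrA.
rewrite -(RintegralB measurableT j1 j2).
rewrite -(RintegralB measurableT (integrableB measurableT j1 j2) j3).
apply: eq_Rintegral => x _; rewrite PmxE colfE.
have -> : \sum_j U j x * colf phi x j 0 = \sum_j U j x * phi j x.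
  by apply: eq_bigr => j _; rewrite colfE.
by ring.
Qed.

Lemma prim_ae f g : @locint R f -> locint g ->
  {ae leb, forall x : measurableTypeR R, f x = g x} -> prim f = prim g.
Proof.
move=> [mf _] [mg _] fg.
have E a b : \int[leb]_(t in `[a, b]) f t = \int[leb]_(t in `[a, b]) g t.
  congr fine; apply: ae_eq_integral => //.
  - by apply/measurable_EFinP; exact: measurable_funTS.
  - by apply/measurable_EFinP; exact: measurable_funTS.
  - by apply: filterS fg => x /= -> _.
by apply/funext => x; rewrite /prim !E.
Qed.

(** The continuous representatives are only known to agree almost everywhere with the square
    integrable functions of the H^1 hypothesis, hence this form up to null sets. *)
Definition L2class (f : R -> R) := exists2 g, g \in Lfun leb 2%:E &
  {ae leb, forall x : measurableTypeR R, g x = f x}.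

(** Bootstrap: phi is a.e. a primitive of its weak derivative g, and g one of P phi. The first fact
    gives a continuous u; then P u is continuous, so its primitive v is C^1 and u, a primitive of v,
    is C^2. *)
Lemma weak_sol_regular phi : (forall i, H1fun (phi i)) ->
  (forall i, eq_distr (linearized mu U phi i) 0) ->
  exists u v : R -> 'cV[R]_N, [/\ sol Pmx u v,
    forall i, {ae leb, forall x : measurableTypeR R, phi i x = u x i 0} &
    forall i, L2class (fun x => v x i 0)].
Proof.
move=> Hphi lin.
have lphi i : locint (phi i) by apply: Lfun2_locint; have [] := Hphi i.
have /choice[g gP] : forall i, exists g : R -> R,
    g \in Lfun leb 2%:E /\ weak_deriv (phi i) g.
  by move=> i; have [_ [g g2 wg]] := Hphi i; exists g.
have lg i : locint (g i) by apply: Lfun2_locint; have [] := gP i.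
pose h i x := (Pmx x *m colf phi x) i 0.
have lh i : locint (h i) by exact: locint_Pmx.
have wh i : weak_deriv (g i) (h i).
  move=> psi tpsi; have [_ /(_ _ (test_function_derive1 tpsi)) <-] := gP i.
  have := lin i _ tpsi; rewrite linearizedE// => /eqP.
  by rewrite addrC subr_eq0 opprK => /eqP ->.
have /choice[c cP] i := weak_deriv_prim (lphi i) (lg i) (gP i).2.
have /choice[c' cP'] i := weak_deriv_prim (lg i) (lh i) (wh i).
pose u x : 'cV[R]_N := \col_i (c i + prim (g i) x).
have cu i : continuous (fun x => u x i 0).
  by under eq_fun do rewrite mxE; move=> x; apply: cvgD; [exact: cvg_cst|exact: prim_continuous].
(* The continuous version of [h]: changing the integrand on a null set leaves [prim] unchanged, and
   makes it differentiable everywhere. *)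
pose k i x := (Pmx x *m u x) i 0.
have ck i : continuous (k i) by exact: Pmx_mul_cont.
have phiu i : {ae leb, forall x : measurableTypeR R, phi i x = u x i 0}.
  by apply: filterS (cP i) => x ->; rewrite mxE.
have hk i : {ae leb, forall x : measurableTypeR R, h i x = k i x}.
  have phiuA : {ae leb, forall x : measurableTypeR R, forall i, phi i x = u x i 0}.
    exact: filter_forall.
  apply: filterS phiuA => x phix; congr ((_ *m _) _ _).
  by apply/colP => j; rewrite colfE.
pose v x : 'cV[R]_N := \col_i (c' i + prim (k i) x).
have dv i x : is_derive x (1 : R) (fun x => v x i 0) (k i x).
  under eq_fun do rewrite mxE.
  have := is_deriveD (is_derive_cst (c' i) x (1 : R)) (is_derive_prim (continuous_locint (ck i)) (ck i x)).
  by rewrite add0r.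
have cv i : continuous (fun x => v x i 0).
  by move=> x; apply/differentiable_continuous/derivable1_diffP; have [] := dv i x.
have gv i : {ae leb, forall x : measurableTypeR R, g i x = v x i 0}.
  apply: filterS (cP' i) => x ->.
  by rewrite mxE (prim_ae (lh i) (continuous_locint (ck i)) (hk i)).
exists u, v; split.
- move=> x; split=> i j; rewrite ord1; last exact: dv.
  under eq_fun do rewrite mxE (prim_ae (lg i) (continuous_locint (cv i)) (gv i)).
  have := is_deriveD (is_derive_cst (c i) x (1 : R)) (is_derive_prim (continuous_locint (cv i)) (cv i x)).
  by rewrite add0r.
- exact: phiu.
- by move=> i; exists (g i) => //; have [] := gP i.
Qed.

Lemma sol_weak u v : sol Pmx u v ->
  (forall i, (fun x => u x i 0) \in Lfun leb 2%:E) ->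
  (forall i, (fun x => v x i 0) \in Lfun leb 2%:E) ->
  (forall i, H1fun (fun x => u x i 0)) /\
  (forall i, eq_distr (linearized mu U (fun i x => u x i 0) i) 0).
Proof.
move=> s u2 v2.
have cv i : continuous (fun x => v x i 0) by have [] := sol_continuous i s.
have cu i : continuous (fun x => u x i 0) by have [] := sol_continuous i s.
have wu i : weak_deriv (fun x => u x i 0) (fun x => v x i 0).
  by apply: weak_deriv_classical => // x; have [du _] := s x; exact: du.
split=> i; first by split; [exact: u2|exists (fun x => v x i 0); [exact: v2|exact: wu]].
have cPu : continuous (fun x => (Pmx x *m u x) i 0) by exact: Pmx_mul_cont.
have wv : weak_deriv (fun x => v x i 0) (fun x => (Pmx x *m u x) i 0).
  by apply: weak_deriv_classical => // x; have [_ dv] := s x; exact: dv.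
move=> psi tpsi; rewrite linearizedE//; last by move=> j; exact: continuous_locint.
have -> : (fun x => (Pmx x *m colf (fun i x => u x i 0) x) i 0 * psi x) =
    (fun x => (Pmx x *m u x) i 0 * psi x).
  apply/funext => x; congr ((_ *m _) _ _ * _).
  by apply/colP => j; rewrite colfE.
rewrite (wu i _ (test_function_derive1 tpsi)) -(wv _ tpsi).
exact: subrr.
Qed.

Lemma wronskian_L2 u v u' v' : sol Pmx u v -> sol Pmx u' v' ->
  (forall i, L2class (fun x => u x i 0)) -> (forall i, L2class (fun x => v x i 0)) ->
  (forall i, L2class (fun x => u' x i 0)) -> (forall i, L2class (fun x => v' x i 0)) ->
  dotv (v 0) (u' 0) = dotv (u 0) (v' 0).
Proof.
move=> s s' u2 v2 u2' v2'.
have L1 (f g : 'I_N -> R -> R) : (forall i, L2class (f i)) -> (forall i, L2class (g i)) ->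
    exists2 w : R -> R, leb.-integrable setT (EFin \o w) &
      {ae leb, forall x : measurableTypeR R, w x = \sum_i f i x * g i x}.
  move=> f2 g2.
  have /choice[F FP] : forall i, exists F : R -> R, F \in Lfun leb 2%:E /\
      {ae leb, forall x : measurableTypeR R, F x = f i x}.
    by move=> i; have [F F2 Ff] := f2 i; exists F.
  have /choice[G GP] : forall i, exists G : R -> R, G \in Lfun leb 2%:E /\
      {ae leb, forall x : measurableTypeR R, G x = g i x}.
    by move=> i; have [G G2 Gg] := g2 i; exists G.
  exists (fun x => \sum_i F i x * G i x).
    have -> : EFin \o (fun x => \sum_i F i x * G i x) =
        (fun x => (\sum_i (F i x * G i x)%:E)%E).
      by apply/funext => x; rewrite /= -sumEFin.
    apply: integrable_sum => // i _.
    by apply/Lfun1_integrable; apply: Lfun2_mul_Lfun1; [have [] := FP i|have [] := GP i].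
  have Ff : {ae leb, forall x : measurableTypeR R, forall i, F i x = f i x}.
    by apply: filter_forall => i; have [] := FP i.
  have Gg : {ae leb, forall x : measurableTypeR R, forall i, G i x = g i x}.
    by apply: filter_forall => i; have [] := GP i.
  apply: filterS2 Ff Gg => x Fx Gx; apply: eq_bigr => i _.
  by rewrite Fx Gx.
have [w iw wE] := L1 _ _ v2 u2'; have [w' iw' wE'] := L1 _ _ u2 v2'.
apply/eqP; rewrite -subr_eq0; apply/eqP.
apply: (@integrable_ae_cst (fun x => w x - w' x)).
  exact: (integrableB measurableT iw iw').
apply: filterS2 wE wE' => x -> ->.
by rewrite -(wronskian_cst Pmx_sym s s' x).
Qed.

End Kernel.

(** * The kernel at the soliton *)

Section SolitonKernel.
Context {R : realType} {N : nat} (mu : 'I_N -> R) (a : 'rV[R]_N).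
Local Notation leb := (@lebesgue_measure R).
Hypothesis N_gt0 : (0 < N)%N.
Hypothesis mu0 : forall i, mu i < 0.
Hypothesis mu_mono : forall i j : 'I_N, (i < j)%N -> mu i < mu j.
Hypothesis a0 : forall i, a 0 i != 0.
Local Notation e := (eta mu).
Local Notation z := (zvec mu a).
Local Notation U := (Usol mu a).
Implicit Types (b : 'cV[R]_N) (x : R).

Lemma eta_lower_bound : exists2 d, 0 < d & forall i, d <= e i.
Proof.
have [i _ imin] := @Order.TotalTheory.arg_minP _ R 'I_N (Ordinal N_gt0) predT e isT.
exists (e i); first exact: eta_gt0.
by move=> j; exact: imin.
Qed.

(** The variation of U = 2 Lam y along b; for b = [bvec c] it is the combination of the parameter
    derivatives with coefficients c. *)
Definition Dsol b x : 'cV[R]_N := 2 *: (Lam e *m phisol e b (z x)).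

Definition Dsol1 b x : 'cV[R]_N := 2 *: (Lam e *m phisol1 e b (z x)).

Definition bvec (c : 'I_N -> R) : 'cV[R]_N := \col_j (c j / a 0 j).

Lemma DsolE b x i : Dsol b x i 0 = 2 * e i * phisol e b (z x) i 0.
Proof. by rewrite coordZ LamE mulrA. Qed.

Lemma sum_dUsol_Dsol (c : 'I_N -> R) i x :
  \sum_k c k * dUsol mu a k i x = Dsol (bvec c) x i 0.
Proof. by rewrite DsolE sum_dUsol. Qed.

Lemma UsolE i x : U i x = 2 * (e i * ysol e (z x) i 0).
Proof. by rewrite Usol_ysol// mulrA. Qed.

Lemma sum_Usol_sqr x : \sum_k U k x ^+ 2 = Qsol e (z x).
Proof.
rewrite /Qsol mulr_sumr; apply: eq_bigr => k _.
by rewrite UsolE !LamE; ring.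
Qed.

Lemma Usol_continuous i : continuous (U i).
Proof.
have -> : U i = (fun x => 2 * (e i * ysol e (z x) i 0)).
  by apply/funext => x; exact: UsolE.
have cy : continuous (fun x => ysol e (z x) i 0).
  move=> x; apply/differentiable_continuous/derivable1_diffP.
  by have [] := mx_derive_ysol_x (eta_gt0 mu0) (mx_derive_zvec mu a) x i 0.
move=> x; apply: cvgM; first exact: cvg_cst.
by apply: cvgM; [exact: cvg_cst|exact: cy].
Qed.

(** The equation for [phisol] multiplied by 2 Lam, with eta_i^2 = - mu_i and the scalars in y
    rewritten through U. *)
Lemma sol_Dsol b : sol (Pmx mu U) (Dsol b) (Dsol1 b).
Proof.
have dz := mx_derive_zvec mu a.
move=> x; split.
  exact: mx_deriveZl (mx_deriveMl _ (mx_derive_phisol (eta_gt0 mu0) dz b x)).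
have := mx_deriveZl 2 (mx_deriveMl (Lam e) (mx_derive_phisol1 (eta_gt0 mu0) dz b x)).
rewrite (_ : _ *: _ = Pmx mu U x *m Dsol b x)//; apply/colP => i.
rewrite PmxE sum_Usol_sqr UsolE DsolE -(eta_sqr mu0).
have -> : \sum_j U j x * Dsol b x j 0 =
    4 * dotv (ysol e (z x)) (Lam e *m (Lam e *m phisol e b (z x))).
  by rewrite mulr_sumr; apply: eq_bigr => j _; rewrite UsolE DsolE !LamE; ring.
by rewrite !(coordE, LamE); ring.
Qed.

Lemma zvec_zexp : z = zexp e a^T.
Proof. by apply/funext => x; apply/colP => j; rewrite !mxE. Qed.

Lemma exp_decay_L2 d (w : R -> 'cV[R]_N) i : 0 < d -> exp_decay d w ->
  continuous (fun x => w x i 0) -> (fun x => w x i 0) \in Lfun leb 2%:E.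
Proof.
move=> d0 [C wC] cw; apply: (exp_decay_Lfun2 d0 cw (C := C)) => x.
exact: le_trans (dotvv_sqr_le _ _) (wC x).
Qed.

Lemma Dsol_L2 b i : (fun x => Dsol b x i 0) \in Lfun leb 2%:E.
Proof.
have [d d0 de] := eta_lower_bound.
apply: (exp_decay_L2 d0); last by have [] := sol_continuous i (sol_Dsol b).
apply: exp_decayZl; apply: exp_decay_Dmx; rewrite zvec_zexp.
apply: exp_decay_phisol => //; first exact: eta_inj.
by move=> j; rewrite mxE.
Qed.

Lemma Dsol1_L2 b i : (fun x => Dsol1 b x i 0) \in Lfun leb 2%:E.
Proof.
have [d d0 de] := eta_lower_bound.
apply: (exp_decay_L2 d0); last by have [] := sol_continuous i (sol_Dsol b).
apply: exp_decayZl; apply: exp_decay_Dmx; rewrite zvec_zexp.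
apply: exp_decay_phisol1 => //; first exact: eta_inj.
by move=> j; rewrite mxE.
Qed.

Lemma Dsol_inj (c : 'I_N -> R) : (forall x, Dsol (bvec c) x = 0) ->
  forall k, c k = 0.
Proof.
move=> D0 k; have [d d0 de] := eta_lower_bound.
have /colP/(_ k) : bvec c = 0.
  apply: (@phisol_inj0 R N e a^T d d0 de); first exact: eta_inj.
    by move=> j; rewrite mxE.
  move=> x; rewrite -zvec_zexp; apply/colP => i; rewrite [RHS]mxE.
  have /colP/(_ i)/eqP := D0 x; rewrite DsolE [X in _ == X]mxE mulf_eq0.
  by rewrite gt_eqF ?mulr_gt0 ?eta_gt0//= => /eqP.
rewrite !mxE => /eqP; rewrite mulf_eq0 invr_eq0 (negPf (a0 k)) orbF.
exact: eqP.
Qed.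

Lemma aeclass_of0 : aeclass_of (0 : R -> R) = 0.
Proof.
rewrite -(scale0r (0 : R -> R)) -aeclass_ofZ.
exact: (scale0r (aeclass_of (0 : R -> R))).
Qed.

Lemma vclass_sum n (c : 'I_n -> R) (phi : 'I_n -> 'I_N -> R -> R) :
  \sum_k c k *: vclass (phi k) = vclass (fun i x => \sum_k c k * phi k i x).
Proof.
apply/funext => i; rewrite fct_sumE /vclass.
have -> : (fun x => \sum_k c k * phi k i x) = \sum_k c k *: phi k i.
  by apply/funext => x; rewrite fct_sumE.
elim: (index_enum _) => [|k r IHr]; first by rewrite !big_nil aeclass_of0.
by rewrite !big_cons aeclass_ofD -aeclass_ofZ IHr.
Qed.

Lemma kerH1_span : kerH1 mu U = lin_span (fun k : 'I_N => vclass (dUsol mu a k)).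
Proof.
apply/seteqP; split => [w [phi [Hphi lin] <-]|w [c ->]]; last first.
  have [H lin] := sol_weak Usol_continuous (sol_Dsol (bvec c)) (Dsol_L2 (bvec c))
    (Dsol1_L2 (bvec c)).
  exists (fun i x => Dsol (bvec c) x i 0); first by split.
  rewrite vclass_sum; congr vclass; apply/funext => i; apply/funext => x.
  by rewrite sum_dUsol_Dsol.
have [u [v [suv phiu v2]]] := weak_sol_regular Usol_continuous Hphi lin.
pose dl (k j : 'I_N) : R := (j == k)%:R.
(* Row k of (A, B) holds the initial data at 0 of the derivative of U in a_k. *)
pose A : 'M[R]_N := \matrix_(k, i) Dsol (bvec (dl k)) 0 i 0.
pose B : 'M[R]_N := \matrix_(k, i) Dsol1 (bvec (dl k)) 0 i 0.
have L2c f : f \in Lfun leb 2%:E -> L2class f by move=> f2; exists f => //; exact: aeW.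
have u2 i : L2class (fun x => u x i 0).
  by exists (phi i); [have [] := Hphi i|exact: phiu].
have sumD (c : 'I_N -> R) x : \sum_k c k *: Dsol (bvec (dl k)) x = Dsol (bvec c) x.
  apply/colP => i; rewrite summxE -sum_dUsol_Dsol; apply: eq_bigr => k _.
  rewrite coordZ -sum_dUsol_Dsol (bigD1 k)//= big1 => [|j jk]; last first.
    by rewrite /dl (negPf jk) mul0r.
  by rewrite /dl eqxx mul1r addr0.
have sD c := sol_sum c (fun k => sol_Dsol (bvec (dl k))).
have rowA (c : 'rV[R]_N) i :
    (c *m A) 0 i = (\sum_k c 0 k *: Dsol (bvec (dl k)) 0) i 0.
  by rewrite mxE summxE; apply: eq_bigr => k _; rewrite coordZ; congr (_ * _); exact: mxE.
have rowB (c : 'rV[R]_N) i :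
    (c *m B) 0 i = (\sum_k c 0 k *: Dsol1 (bvec (dl k)) 0) i 0.
  by rewrite mxE summxE; apply: eq_bigr => k _; rewrite coordZ; congr (_ * _); exact: mxE.
have Pc i j : continuous (fun x => Pmx mu U x i j) := @Pmx_cont _ _ mu _ Usol_continuous i j.
(* A combination of rows with zero initial data is the zero solution, so its coefficients vanish;
   isotropy of the rows and orthogonality of (u, v) to them are both vanishing Wronskians. *)
have [] := @lagrangian_complete _ _ A B (u 0)^T (v 0)^T.
- move=> c cA cB; apply/rowP => k; rewrite [RHS]mxE.
  apply: (@Dsol_inj (fun k => c 0 k)) => x; rewrite -sumD.
  apply: (sol_eq0 Pc (sD _)).
    by apply/colP => i; rewrite -rowA cA !mxE.
  by apply/colP => i; rewrite -rowB cB !mxE.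
- apply/matrixP => k l; rewrite mxE [RHS]mxE.
  transitivity (dotv (Dsol1 (bvec (dl k)) 0) (Dsol (bvec (dl l)) 0)).
    by apply: eq_bigr => i _; rewrite !mxE.
  transitivity (dotv (Dsol (bvec (dl k)) 0) (Dsol1 (bvec (dl l)) 0)).
    exact: wronskian_L2 (sol_Dsol _) (sol_Dsol _)
      (fun i => L2c _ (Dsol_L2 _ i)) (fun i => L2c _ (Dsol1_L2 _ i))
      (fun i => L2c _ (Dsol_L2 _ i)) (fun i => L2c _ (Dsol1_L2 _ i)).
  by apply: eq_bigr => i _; rewrite !mxE.
- apply/rowP => l; rewrite mxE [RHS]mxE.
  transitivity (dotv (v 0) (Dsol (bvec (dl l)) 0)).
    by apply: eq_bigr => i _; rewrite !mxE.
  transitivity (dotv (u 0) (Dsol1 (bvec (dl l)) 0)).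
    exact: wronskian_L2 suv (sol_Dsol _) u2 v2
      (fun i => L2c _ (Dsol_L2 _ i)) (fun i => L2c _ (Dsol1_L2 _ i)).
  by apply: eq_bigr => i _; rewrite !mxE.
move=> c [uA vB].
(* Equal initial data at 0 propagate to the whole line by uniqueness. *)
have uD x : u x = Dsol (bvec (fun k => c 0 k)) x.
  apply/eqP; rewrite -subr_eq0 -sumD; apply/eqP.
  apply: (sol_eq0 Pc (solB suv (sD _))).
    apply/eqP; rewrite subr_eq0; apply/eqP/colP => i.
    by rewrite -rowA -uA mxE.
  apply/eqP; rewrite subr_eq0; apply/eqP/colP => i.
  by rewrite -rowB -vB mxE.
exists (fun k => c 0 k); rewrite vclass_sum; apply/funext => i.
apply/aeclass_eqP; apply: filterS (phiu i) => x ->.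
by rewrite uD sum_dUsol_Dsol.
Qed.

(** A combination vanishing as a class vanishes almost everywhere, hence everywhere by continuity,
    and pointwise independence applies. *)
Lemma lin_indep_dUsol : lin_indep (fun k : 'I_N => vclass (dUsol mu a k)).
Proof.
move=> c; rewrite vclass_sum => c0; apply: Dsol_inj => x; apply/colP => i.
have : aeclass_of (fun x => Dsol (bvec c) x i 0) = aeclass_of (0 : R -> R).
  rewrite aeclass_of0 -[RHS]/((0 : 'I_N -> aeclass R) i) -c0; congr aeclass_of.
  by apply/funext => t; rewrite sum_dUsol_Dsol.
move=> /aeclass_eqP h; have [cD _] := sol_continuous i (sol_Dsol (bvec c)).
have /(congr1 (fun f => f x)) := continuous_ae_eq cD (@cst_continuous _ _ 0) h.
by move=> /= ->; rewrite mxE.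
Qed.

End SolitonKernel.

Unset Implicit Arguments.
Set Strict Implicit.
Set Printing Implicit Defensive.

Theorem theorem1p2 (R : realType) (N : nat) (mu : 'I_N -> R) (a : 'rV[R]_N)
  (hN : (2 <= N)%N)
  (hmu : forall i j : 'I_N, (i < j)%N -> mu i < mu j)
  (hmu0 : forall i : 'I_N, mu i < 0)
  (ha : forall i : 'I_N, a 0 i != 0) :
  has_dim (kerH1 mu (Usol mu a)) N /\
  kerH1 mu (Usol mu a) = lin_span (fun k : 'I_N => vclass (dUsol mu a k)).
Proof.
have N_gt0 : (0 < N)%N by rewrite (leq_trans _ hN).
have span := kerH1_span N_gt0 hmu0 hmu ha.
split; last exact: span.
exists (fun k => vclass (dUsol mu a k)); last exact: span.
exact: lin_indep_dUsol N_gt0 hmu0 hmu ha.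
Qed.
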